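(* Let $(X,\mu)$ be a standard non-atomic Lebesgue space with finite (non-zero) measure $\mu$. The topological group $\mathrm{Aut}(X,\mu)_u$, i.e. the group $\mathrm{Aut}(X,\mu)$ of measure-preserving automorphisms of $(X,\mu)$ equipped with the uniform topology, is non-amenable.
   Context: $\mathrm{Aut}(X,\mu)$ is the group of (equivalence classes modulo null sets of) invertible measurable measure-preserving transformations of $X$. The uniform topology is the group topology given by the metric $d_{unif}(\tau,\sigma)=\mu\{x\in X: \tau(x)\neq\sigma(x)\}$. A topological group $G$ is amenable if every continuous action of $G$ by affine transformations on a (non-empty) convex compact subset of a (locally convex Hausdorff) topological vector space has a fixed point; equivalently, if there is a left-invariant mean on the space of all bounded right uniformly continuous complex-valued functions on $G$. *)

(* Defs.v *)
From HB Require Import structures.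
From mathcomp Require Import all_boot all_order all_algebra.
From mathcomp Require Import generic_quotient.
From mathcomp Require Import all_classical all_reals all_analysis.
Import Order.TTheory GRing.Theory Num.Theory.
Import numFieldNormedType.Exports.

Set Implicit Arguments.
Unset Strict Implicit.
Unset Printing Implicit Defensive.

Local Open Scope classical_set_scope.
Local Open Scope ring_scope.
Local Open Scope quotient_scope.

HB.mixin Record Group_isTopologicalGroup G of Topological G & Group G := {
  mulg_continuous : continuous (fun x : G * G => (x.1 * x.2)%g) ;
  invg_continuous : continuous (fun x : G => (x^-1)%g) }.

#[short(type="topologicalGroupType")]
HB.structure Definition TopologicalGroup :=
  {G of Topological G & Group G & Group_isTopologicalGroup G}.

(* A left action of G on the subset K of E; the values of [act] outside K are
   irrelevant.  Continuity is joint continuity of G * K -> K. *)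
Record continuous_affine_action (R : realType) (G : topologicalGroupType)
    (E : tvsType R) (K : set E) (act : G -> E -> E) : Prop := {
  act_stable : forall g x, K x -> K (act g x) ;
  act1 : forall x, K x -> act 1%g x = x ;
  actM : forall g h x, K x -> act (g * h)%g x = act g (act h x) ;
  act_affine : forall g x y (t : R), K x -> K y -> 0 <= t -> t <= 1 ->
    act g (t *: x + (1 - t) *: y) = t *: act g x + (1 - t) *: act g y ;
  act_continuous : {within [set p : G * E | K p.2],
    continuous (fun p : G * E => act p.1 p.2)} }.

(* [tvsType] already includes local convexity, but not separation.  Complex
   locally convex spaces are real ones by restriction of scalars. *)
Definition amenable (R : realType) (G : topologicalGroupType) : Prop :=
  forall (E : tvsType R) (K : set E) (act : G -> E -> E),
    hausdorff_space E -> K !=set0 -> compact K -> convex_set K ->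
    continuous_affine_action K act ->
    exists2 x, K x & forall g, act g x = x.

Section lebesgue_space.
Context (R : realType).

(* Isomorphism of measure spaces between conull measurable subsets. *)
Definition isomorphic_mod0 d1 d2 (T1 : measurableType d1)
    (T2 : measurableType d2) (mu : {measure set T1 -> \bar R})
    (nu : {measure set T2 -> \bar R}) : Prop :=
  exists (X : set T1) (Y : set T2) (f : T1 -> T2),
    [/\ [/\ measurable X, measurable Y, mu (~` X) = 0%E & nu (~` Y) = 0%E],
        set_bij X Y f,
        measurable_fun X f,
        (forall A, measurable A -> A `<=` X -> measurable (f @` A)) &
        (forall B, measurable B -> mu (X `&` f @^-1` B) = nu B)].

Section model.
Variables (s : {nonneg R}) (p : nat -> {nonneg R}).

(* The interval [0, s] with Lebesgue measure together with countably many
   further points: the n-th one, of mass [p n], is placed at -(n + 1), and is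
   null, hence absent mod 0, when [p n = 0]. *)
Definition lebesgue_model : {measure set (measurableTypeR R) -> \bar R} :=
  measure_add
    (mrestr (@lebesgue_measure R)
       (measurable_itv `[0%R, s%:num] : measurable (_ : set (measurableTypeR R))))
    (mseries (fun n => mscale (p n) \d_(- n.+1%:R : measurableTypeR R)) 0).

End model.

(* Lebesgue space in the sense of Rokhlin; both the convention where the
   sigma-algebra is Borel and the one where it is complete are allowed. *)
Definition lebesgue_space d (T : measurableType d)
    (mu : {measure set T -> \bar R}) : Prop :=
  exists (s : {nonneg R}) (p : nat -> {nonneg R}),
    isomorphic_mod0 mu (lebesgue_model s p) \/
    isomorphic_mod0 mu
      (@completed_measure_extension _ _ _ (lebesgue_model s p)).

Definition atom d (T : measurableType d) (mu : {measure set T -> \bar R})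
    (A : set T) : Prop :=
  [/\ measurable A, (0 < mu A)%E &
      forall B, measurable B -> B `<=` A -> mu B = 0%E \/ mu B = mu A].

Definition nonatomic d (T : measurableType d)
    (mu : {measure set T -> \bar R}) : Prop :=
  forall A, ~ atom mu A.

End lebesgue_space.

Section automorphisms.
Context d (T : measurableType d) (R : realType).
Variable mu : {finite_measure set T -> \bar R}.

Record mp_bijection := MpBijection {
  mp_fun :> T -> T ;
  mp_inv : T -> T ;
  mp_funK : cancel mp_fun mp_inv ;
  mp_invK : cancel mp_inv mp_fun ;
  mp_fun_measurable : measurable_fun setT mp_fun ;
  mp_inv_measurable : measurable_fun setT mp_inv ;
  mp_preserving : forall A, measurable A -> mu (mp_fun @^-1` A) = mu A }.

HB.instance Definition _ := gen_eqMixin mp_bijection.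
HB.instance Definition _ := gen_choiceMixin mp_bijection.

Implicit Types f g h : mp_bijection.

Definition mp_id : mp_bijection.
Proof. by exists id id => //; exact: measurable_id. Defined.

Definition mp_comp f g : mp_bijection.
Proof.
exists (f \o g) (mp_inv g \o mp_inv f).
- exact: can_comp (mp_funK f) (mp_funK g).
- exact: can_comp (mp_invK g) (mp_invK f).
- exact: measurableT_comp (mp_fun_measurable f) (mp_fun_measurable g).
- exact: measurableT_comp (mp_inv_measurable g) (mp_inv_measurable f).
- move=> A mA; rewrite comp_preimage mp_preserving ?mp_preserving//.
  by rewrite -[X in measurable X]setTI; exact: mp_fun_measurable.
Defined.

Definition mp_inverse f : mp_bijection.
Proof.
exists (mp_inv f) f.
- exact: mp_invK.
- exact: mp_funK.
- exact: mp_inv_measurable.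
- exact: mp_fun_measurable.
- move=> A mA; rewrite -(mp_preserving f).
    by rewrite -comp_preimage; congr (mu _); apply/seteqP; split=> x /=;
       rewrite mp_funK.
  by rewrite -[X in measurable X]setTI; exact: mp_inv_measurable.
Defined.

Lemma mp_ext_preimage f (A : set T) : ((mu^*)%mu (f @^-1` A) <= (mu^*)%mu A)%E.
Proof.
apply: le_ereal_inf_tmp => _ [F [mF AF] <-]; apply: ereal_inf_lbound => /=.
exists (fun k => f @^-1` F k).
  split=> [i|x /AF[k _ Fk]]; last by exists k.
  by rewrite -[X in measurable X]setTI; exact: mp_fun_measurable.
by apply: eq_eseriesr => k _; rewrite mp_preserving.
Qed.

(* mu^* is the outer measure induced by mu: it agrees with mu on measurable
   sets, so the metric below makes sense without knowing that the set of
   disagreement is measurable. *)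
Definition mp_dist f g : R := fine ((mu^*)%mu [set x | f x <> g x]).

Lemma mp_distE f g : measurable [set x | f x <> g x] ->
  mp_dist f g = fine (mu [set x | f x <> g x]).
Proof. by move=> mD; rewrite /mp_dist measurable_mu_extE. Qed.

Lemma mu_ext_fin_num (A : set T) : (mu^*)%mu A \is a fin_num.
Proof.
rewrite ge0_fin_numE ?mu_ext_ge0//.
apply: (@le_lt_trans _ _ ((mu^*)%mu setT)); first exact: le_mu_ext.
by rewrite measurable_mu_extE// -ge0_fin_numE// fin_num_measure.
Qed.

Lemma mu_ext0_negligible (A : set T) :
  (mu^*)%mu A = 0%E -> mu.-negligible A.
Proof.
move=> A0.
have cover n : exists B, [/\ measurable B, A `<=` B &
    (mu B <= (n.+1%:R^-1)%:E)%E].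
  have n0 : 0 < n.+1%:R^-1 :> R by rewrite invr_gt0 ltr0n.
  have /(lb_ereal_inf_adherent n0)[_ [F [mF AF] <-]] :
    (mu^*)%mu A \is a fin_num by exact: mu_ext_fin_num.
  rewrite -[ereal_inf _]/((mu^*)%mu A) A0 add0e => lt_n.
  exists (\bigcup_k F k); split => //; first exact: bigcupT_measurable.
  apply: le_trans _ (ltW lt_n).
  by apply: measure_sigma_subadditive => //; exact: bigcupT_measurable.
have {cover}[B BP] := choice cover.
have mB : measurable (\bigcap_n B n).
  by apply: bigcapT_measurable => n; have [] := BP n.
exists (\bigcap_n B n); split => //; last first.
  by move=> x Ax n _; have [_ AB _] := BP n; exact: AB.
apply/eqP; rewrite eq_le measure_ge0 andbT.
apply/lee_addgt0Pr => e e0; rewrite add0e.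
have [n /ltW ne] := ltr_add_invr (e0 : 0 < e); rewrite add0r in ne.
have [mBn _ Bn] := BP n.
apply: (@le_trans _ _ (mu (B n))).
  by apply: le_measure; rewrite ?inE//; exact: bigcap_inf.
by apply: (le_trans Bn); rewrite lee_fin.
Qed.

Lemma mp_dist_ge0 f g : 0 <= mp_dist f g.
Proof. by apply: fine_ge0; exact: mu_ext_ge0. Qed.

Lemma mp_distxx f : mp_dist f f = 0.
Proof.
rewrite /mp_dist [X in (mu^*)%mu X](_ : _ = set0) ?mu_ext0//.
by rewrite -subset0 => x /=; exact.
Qed.

Lemma mp_dist_sym f g : mp_dist f g = mp_dist g f.
Proof.
by congr (fine ((mu^*)%mu _)); apply/seteqP; split=> x /= /nesym.
Qed.

Lemma mu_ext_fineU (A B C : set T) : A `<=` B `|` C ->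
  fine ((mu^*)%mu A) <= fine ((mu^*)%mu B) + fine ((mu^*)%mu C).
Proof.
move=> ABC; rewrite -fineD ?mu_ext_fin_num// fine_le ?fin_numD ?mu_ext_fin_num//.
apply: le_trans _ (outer_measureU2 (mu^*)%mu B C).
exact: le_mu_ext.
Qed.

Lemma mp_dist_triangle g f h : mp_dist f h <= mp_dist f g + mp_dist g h.
Proof.
apply: mu_ext_fineU => x /= fh; apply/not_andP => -[fg gh].
by apply: fh; rewrite fg gh.
Qed.

Lemma mp_dist_comp f g f' g' :
  mp_dist (mp_comp f g) (mp_comp f' g') <= mp_dist f f' + mp_dist g g'.
Proof.
pose D := [set x | f x <> f' x].
apply: (@le_trans _ _ (fine ((mu^*)%mu (g @^-1` D)) + mp_dist g g')).
  apply: mu_ext_fineU => x /= neq; apply/not_andP => -[fg gg].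
  by apply: neq; rewrite -gg; apply: contrapT.
by rewrite lerD2r fine_le ?mu_ext_fin_num// mp_ext_preimage.
Qed.

Lemma mp_dist_inverse f g : mp_dist (mp_inverse f) (mp_inverse g) <= mp_dist f g.
Proof.
rewrite fine_le ?mu_ext_fin_num//.
apply: le_trans _ (mp_ext_preimage (mp_inverse f) _).
apply: le_mu_ext => x /= neq eqfg; apply: neq.
by rewrite -[in RHS](mp_invK f x) eqfg mp_funK.
Qed.

Definition mp_ae_eq f g : bool := `[< \forall x \ae mu, f x = g x >].

Lemma mp_ae_eqP f g : reflect (\forall x \ae mu, f x = g x) (mp_ae_eq f g).
Proof. exact: asboolP. Qed.

Lemma mp_dist0P f g : mp_dist f g = 0 <-> mp_ae_eq f g.
Proof.
split=> [fg0|/mp_ae_eqP[N [mN N0 fgN]]].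
  apply/mp_ae_eqP/mu_ext0_negligible.
  by rewrite -[LHS]fineK ?mu_ext_fin_num//; congr EFin.
apply/eqP; rewrite eq_le mp_dist_ge0 andbT -[leRHS]/(fine 0%E).
rewrite fine_le ?mu_ext_fin_num//.
by rewrite -N0 -measurable_mu_extE//; exact: le_mu_ext.
Qed.

Lemma mp_ae_eq_equiv : equiv_class_of mp_ae_eq.
Proof.
split=> [f|f g|g f h].
- by apply/mp_dist0P; exact: mp_distxx.
- by apply/idP/idP => /mp_dist0P fg; apply/mp_dist0P; rewrite mp_dist_sym.
- move=> /mp_dist0P fg /mp_dist0P gh; apply/mp_dist0P/eqP.
  rewrite eq_le mp_dist_ge0 andbT.
  by rewrite (le_trans (mp_dist_triangle g _ _))// fg gh addr0.
Qed.

Canonical mp_ae_eq_rel := EquivRelPack mp_ae_eq_equiv.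

(* Aut(X, mu): measure-preserving bijections up to almost everywhere equality *)
Definition Aut := {eq_quot mp_ae_eq_rel}.

HB.instance Definition _ := Choice.on Aut.
HB.instance Definition _ := EqQuotient.on Aut.

Implicit Types a b c : Aut.

Lemma Aut_piP f g : \pi_Aut f = \pi_Aut g <-> mp_dist f g = 0.
Proof.
split=> [/eqP|/mp_dist0P fg]; first by rewrite eqmodE => /mp_dist0P.
by apply/eqP; rewrite eqmodE.
Qed.

Lemma mp_dist_repr f : mp_dist (repr (\pi_Aut f)) f = 0.
Proof. by apply/Aut_piP; rewrite reprK. Qed.

Definition Aut_one : Aut := \pi_Aut mp_id.
Definition Aut_mul a b : Aut := \pi_Aut (mp_comp (repr a) (repr b)).
Definition Aut_inv a : Aut := \pi_Aut (mp_inverse (repr a)).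
Definition Aut_dist a b : R := mp_dist (repr a) (repr b).

Lemma Aut_mul_pi f g :
  Aut_mul (\pi_Aut f) (\pi_Aut g) = \pi_Aut (mp_comp f g).
Proof.
apply/Aut_piP/eqP; rewrite eq_le mp_dist_ge0 andbT.
by rewrite (le_trans (mp_dist_comp _ _ _ _))// !mp_dist_repr addr0.
Qed.

Lemma Aut_inv_pi f : Aut_inv (\pi_Aut f) = \pi_Aut (mp_inverse f).
Proof.
apply/Aut_piP/eqP; rewrite eq_le mp_dist_ge0 andbT.
by rewrite (le_trans (mp_dist_inverse _ _))// mp_dist_repr.
Qed.

Lemma Aut_dist_pi f g : Aut_dist (\pi_Aut f) (\pi_Aut g) = mp_dist f g.
Proof.
apply/eqP; rewrite eq_le /Aut_dist; apply/andP; split.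
  rewrite (le_trans (mp_dist_triangle f _ _))// mp_dist_repr add0r.
  rewrite (le_trans (mp_dist_triangle g _ _))//.
  by rewrite (mp_dist_sym g) mp_dist_repr addr0.
rewrite (le_trans (mp_dist_triangle (repr (\pi_Aut f)) _ _))//.
rewrite mp_dist_sym mp_dist_repr add0r.
rewrite (le_trans (mp_dist_triangle (repr (\pi_Aut g)) _ _))//.
by rewrite mp_dist_repr addr0.
Qed.

Lemma mp_eq_pi f g : f =1 g -> \pi_Aut f = \pi_Aut g.
Proof.
move=> fg; apply/Aut_piP/mp_dist0P/mp_ae_eqP.
by apply: aeW => x; exact: fg.
Qed.

Lemma Aut_mulA : associative Aut_mul.
Proof.
elim/quotW=> f; elim/quotW=> g; elim/quotW=> h.
rewrite (Aut_mul_pi g h) (Aut_mul_pi f g) !Aut_mul_pi.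
exact: mp_eq_pi.
Qed.

Lemma Aut_mul1 : left_id Aut_one Aut_mul.
Proof. by elim/quotW=> f; rewrite Aut_mul_pi; exact: mp_eq_pi. Qed.

Lemma Aut_mulr1 : right_id Aut_one Aut_mul.
Proof. by elim/quotW=> f; rewrite Aut_mul_pi; exact: mp_eq_pi. Qed.

Lemma Aut_mulV : left_inverse Aut_one Aut_inv Aut_mul.
Proof.
elim/quotW=> f; rewrite Aut_inv_pi Aut_mul_pi; apply: mp_eq_pi => x /=.
exact: mp_funK.
Qed.

Lemma Aut_mulrV : right_inverse Aut_one Aut_inv Aut_mul.
Proof.
elim/quotW=> f; rewrite Aut_inv_pi Aut_mul_pi; apply: mp_eq_pi => x /=.
exact: mp_invK.
Qed.

HB.instance Definition _ :=
  isGroup.Build Aut Aut_mulA Aut_mul1 Aut_mulr1 Aut_mulV Aut_mulrV.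

Lemma Aut_distxx a : Aut_dist a a = 0.
Proof. exact: mp_distxx. Qed.

Lemma Aut_dist_positivity a b : Aut_dist a b = 0 -> a = b.
Proof. by move=> /Aut_piP; rewrite !reprK. Qed.

Lemma Aut_dist_sym a b : Aut_dist a b = Aut_dist b a.
Proof. exact: mp_dist_sym. Qed.

Lemma Aut_dist_triangle b a c : Aut_dist a c <= Aut_dist a b + Aut_dist b c.
Proof. exact: mp_dist_triangle. Qed.

HB.instance Definition _ := isMetric.Build R Aut
  Aut_distxx Aut_dist_positivity Aut_dist_sym Aut_dist_triangle.

Lemma Aut_dist_mul a b a' b' :
  Aut_dist (a * b)%g (a' * b')%g <= Aut_dist a a' + Aut_dist b b'.
Proof. by rewrite Aut_dist_pi; exact: mp_dist_comp. Qed.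

Lemma Aut_dist_inv a b : Aut_dist (a^-1)%g (b^-1)%g <= Aut_dist a b.
Proof. by rewrite Aut_dist_pi; exact: mp_dist_inverse. Qed.

Lemma Aut_ballE a e : ball a e = [set b | Aut_dist a b < e].
Proof. exact: ballEmdist. Qed.

Lemma Aut_mul_continuous : continuous (fun x : Aut * Aut => (x.1 * x.2)%g).
Proof.
move=> [a b]; apply/cvg_ballP => e e0 /=.
exists (ball a (e / 2), ball b (e / 2)) => /=.
  by split; apply: nbhsx_ballx; rewrite divr_gt0.
move=> [a' b'] /= []; rewrite !Aut_ballE /= => aa' bb'.
by rewrite (le_lt_trans (Aut_dist_mul _ _ _ _))// [e]splitr ltrD.
Qed.

Lemma Aut_inv_continuous : continuous (fun x : Aut => (x^-1)%g).
Proof.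
move=> a.
apply: (iffRL (@cvg_ballP _ _ _ _ (@nbhs_filter Aut a) _ _)) => e e0.
apply: (@filterS _ (nbhs a) _ _ _ _ (nbhsx_ballx a _ e0)) => b; rewrite !Aut_ballE /=.
exact: le_lt_trans (Aut_dist_inv _ _).
Qed.

HB.instance Definition _ := Group_isTopologicalGroup.Build Aut
  Aut_mul_continuous Aut_inv_continuous.

End automorphisms.

(* Main.v *)
Require Import Defs.
From HB Require Import structures.
From mathcomp Require Import all_boot all_order all_algebra finmap.
From mathcomp Require Import all_classical all_reals all_analysis.
From mathcomp Require Import measurable_realfun ring lra zify.
Import Order.TTheory GRing.Theory Num.Theory.
Import numFieldNormedType.Exports.

Set Implicit Arguments.
Unset Strict Implicit.
Unset Printing Implicit Defensive.

Local Open Scope classical_set_scope.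
Local Open Scope ring_scope.

(** The uniform metric is bi-invariant, so the means on the space of bounded
uniformly continuous functions form a compact convex set on which the group
acts continuously; amenability yields an invariant mean [m].  Identify [X] with
the Cantor space through binary digits.  For a measurable set [B] let [c_F(B)]
be its Walsh coefficients, indexed by the finite sets [F] of digits, and put
[f_U(g) = sum_F (|F `&` U| / |F|) * c_F(g A)^2], where [U] is a set of digits
and [A] is the set of points whose first digit is [1].  Permuting the digits by
an involution is an automorphism of [X], and left translation by it changes
[f_U] into [f_(pi^-1 U)].  Involutions of [nat] exchange the even numbers with
the odd ones, with [4 nat + 1] and with [4 nat + 3].  Hence
[m(f_even) = m(f_odd) = m(f_odd) + m(f_odd)] vanishes, whereas by Parseval
[f_even + f_odd] is the positive constant [mu A * mu X - (mu A)^2]. *)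

(** * The locally convex space of functions with pointwise convergence *)

(** Dividing by [|F|] attaches to each nonempty finite [F] the uniform probability on [F], a choice
    that commutes with every permutation of [nat]. Weighting these probabilities by [c_F(g A)^2]
    gives, for each [g], a measure [U -> f_U(g)] on [nat] whose total mass is independent of [g],
    because [mu (g A) = mu A]. Its average under [m] would be a finitely additive measure on [nat],
    of positive mass and invariant under all involutions, while [nat] is paradoxical for its
    involutions. The empty set carries no probability, hence the subtracted term [(mu A)^2]. Squares
    of coefficients are taken because Bessel's inequality then controls the variation of [f_U] by
    [mu (g A + h A)], where [+] is symmetric difference; so [f_U] is uniformly continuous for the
    uniform metric and lies in the domain of [m]. Involutions are convenient twice: a measurable
    involution is its own measurable inverse, and it can be corrected on a null set by making it the
    identity outside an invariant conull set. *)

Definition pointwise_space (I : Type) (R : realType) : Type := I -> R^o.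

HB.instance Definition _ I R := GRing.Lmodule.copy (pointwise_space I R) (I -> R^o).
HB.instance Definition _ I (R : realType) :=
  Uniform.copy (pointwise_space I R) (prod_topology (fun _ : I => (R^o : uniformType))).

Section pointwise_space.
Context (I : Type) (R : realType).
Local Notation E := (pointwise_space I R).

Lemma cvg_pointwiseP (F : set_system E) (f : E) : Filter F ->
  F --> f <-> forall i, h i @[h --> F] --> (f i : R^o).
Proof.
move=> FF; split=> [Ff i|Ff].
  move=> A /= Afi; apply: Ff.
  have Ff : nbhs f --> (f : prod_topology (fun _ : I => R^o)) by exact: cvg_id.
  have /cvg_sup/(_ i) Fi := Ff; apply: Fi.
  exact: (@initial_continuous _ _ (fun h : I -> R^o => h i) f A Afi).
apply/cvg_sup => i A [B [[C oC <-] Bf] BA].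
apply: filterS BA _.
by have := Ff i C; apply; apply: open_nbhs_nbhs.
Qed.

Lemma cvg_eval (f : E) i : h i @[h --> f] --> (f i : R^o).
Proof. by have /cvg_pointwiseP := @cvg_id _ (nbhs f). Qed.

Let pointwise_add_continuous : continuous (fun x : E * E => x.1 + x.2).
Proof.
move=> [f g]; apply/cvg_pointwiseP => i.
apply: (@cvgD _ R^o (E * E)%type (nbhs (f, g)) _ (fun x => x.1 i) (fun x => x.2 i) (f i) (g i)).
- by move=> A /(@cvg_eval f i) Af; exact: (@cvg_fst _ _ (nbhs f) (nbhs g) _ _ Af).
- by move=> A /(@cvg_eval g i) Ag; exact: (@cvg_snd _ _ (nbhs f) (nbhs g) _ _ Ag).
Qed.

Let pointwise_scale_continuous : continuous (fun z : R^o * E => z.1 *: z.2).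
Proof.
move=> [r f]; apply/cvg_pointwiseP => i /=.
apply: (@cvgZ _ R^o (R^o * E)%type (nbhs (r, f)) _ (fun x => x.1) (fun x => x.2 i) r (f i)).
- exact: cvg_fst.
- by move=> A /(@cvg_eval f i) Af; exact: (@cvg_snd _ _ (nbhs r) (nbhs f) _ _ Af).
Qed.

Let pointwise_locally_convex :
  exists2 B : set_system E, (forall b, b \in B -> convex_set b) & basis B.
Proof.
exists [set U | open U /\ convex_set U]; first by move=> b /[!inE] -[].
split=> [b [] //|f].
have FF : Filter (filter_from [set U | [set U : set E | open U /\ convex_set U] U /\ U f] id).
  apply: filter_from_filter.
    exists setT; split => //; split; first exact: openT.
    by move=> x y l _ _; rewrite inE.
  move=> U V [[oU cU] Uf] [[oV cV] Vf]; exists (U `&` V) => //=.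
  split => //; split; first exact: openI.
  move=> x y l; rewrite !inE => -[Ux Vx] [Uy Vy].
  by split; apply: set_mem; [apply: cU|apply: cV]; rewrite inE.
(* Convergence of the filter generated by the convex open neighbourhoods is tested one coordinate at
   a time, and the slab [|f i - h i| < e] is itself convex and open. *)
apply/cvg_pointwiseP => i; apply/cvg_ballP => e e0 /=.
exists [set h : E | ball (f i : R^o) e (h i)] => //=; split; last exact: ballxx.
split.
  rewrite openE => h /= fh; have := @cvg_eval h i (ball (f i : R^o) e); apply.
  by apply: open_nbhs_nbhs; split => //; exact: ball_open.
move=> x y l; rewrite !inE /= -!ball_normE /= => fx fy.
have -> : f i - (conv l x y : E) i =
    l%:num * (f i - x i) + (1 - l%:num) * (f i - y i).
  have -> : (conv l x y : E) i = l%:num * x i + (1 - l%:num) * y i by [].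
  move: (f i) (x i) (y i) l%:num => /= p q r t; rewrite !mulrBr mulrBl mul1r.
  rewrite opprD mulrBl mul1r.
  by ring.
have l0 : 0 <= l%:num by [].
have l1 : 0 <= 1 - l%:num by rewrite subr_ge0.
rewrite (le_lt_trans (ler_normD _ _))// !normrM (ger0_norm l0) (ger0_norm l1).
have [l00|l00] := eqVneq (l%:num) 0; first by rewrite l00; lra.
have {l00} l0 : 0 < l%:num by rewrite lt_neqAle eq_sym l00.
nra.
Qed.

HB.instance Definition _ :=
  PreTopologicalNmodule_isTopologicalNmodule.Build E pointwise_add_continuous.
HB.instance Definition _ :=
  TopologicalNmodule_isTopologicalLmodule.Build R E pointwise_scale_continuous.
HB.instance Definition _ :=
  Uniform_isTvs.Build R E pointwise_locally_convex.

Lemma pointwise_hausdorff : hausdorff_space E.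
Proof.
have := @hausdorff_product {classic I} (fun=> R^o).
apply => i; exact: Rhausdorff.
Qed.

Lemma pointwise_compact (c : I -> R) : compact [set f : E | forall i, `|f i| <= c i].
Proof.
have := @tychonoff {classic I} (fun=> R^o) (fun i => [set x : R^o | `|x| <= c i]).
apply => i.
have -> : [set x : R^o | `|x| <= c i] = [set` `[- c i, c i]%R] :> set R^o.
  by apply/seteqP; split=> x /=; rewrite in_itv /= ler_norml.
exact: segment_compact.
Qed.

End pointwise_space.

(** * Invariant means *)

Section invariant_mean.
Context (R : realType) (d : measure_display) (T : measurableType d).
Variable mu : {finite_measure set T -> \bar R}.
Local Notation G := (Aut mu).
Implicit Types h k : G -> R.

(** As the metric is bi-invariant, left and right uniform continuity are the same notion, and this
    one serves both for translating functions and for the continuity of the action. *)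
Definition bounded_uc h : Prop :=
  (exists M, forall g, `|h g| <= M) /\
  forall e, 0 < e -> exists2 r, 0 < r &
    forall a b, Aut_dist a b < r -> `|h a - h b| < e.

Lemma bounded_uc_cst c : bounded_uc (fun=> c).
Proof.
split; first by exists `|c|.
by move=> e e0; exists 1 => // a b _; rewrite subrr normr0.
Qed.

Lemma bounded_uc_lin t h k : bounded_uc h -> bounded_uc k ->
  bounded_uc (fun g => h g + t * k g).
Proof.
move=> [[M hM] uh] [[N kN] uk]; split.
  exists (M + `|t| * N) => g; rewrite (le_trans (ler_normD _ _))// lerD//.
  by rewrite normrM ler_wpM2l.
move=> e e0; have t1 : 0 < `|t| + 1 by rewrite ltr_wpDl.
have e20 : 0 < e / 2 by rewrite divr_gt0.
have [r1 r10 H1] := uh _ e20; have [r2 r20 H2] := uk _ (divr_gt0 e20 t1).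
exists (Num.min r1 r2); first by rewrite lt_min r10.
move=> a b; rewrite lt_min => /andP[/H1 h1 /H2 h2].
rewrite [X in `|X|](_ : _ = (h a - h b) + t * (k a - k b)); last by ring.
rewrite (le_lt_trans (ler_normD _ _))// [e]splitr ltr_leD// normrM.
rewrite (@le_trans _ _ ((`|t| + 1) * `|k a - k b|))//.
  by rewrite ler_wpM2r// lerDl.
by rewrite mulrC -ler_pdivlMr// ltW.
Qed.

Lemma Aut_dist_mull (g a b : G) : Aut_dist (g * a)%g (g * b)%g <= Aut_dist a b.
Proof. by rewrite (le_trans (Aut_dist_mul _ _ _ _))// Aut_distxx add0r. Qed.

Lemma bounded_uc_translate g h : bounded_uc h -> bounded_uc (fun a => h (g * a)%g).
Proof.
move=> [[M hM] uh]; split; first by exists M.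
move=> e /uh[r r0 H]; exists r => // a b ab; apply: H.
exact: le_lt_trans (Aut_dist_mull _ _ _) ab.
Qed.

Lemma bounded_uc_translateN g h :
  ~ bounded_uc h -> ~ bounded_uc (fun a => h (g * a)%g).
Proof.
apply: contra_not => /(bounded_uc_translate g^-1%g).
by congr bounded_uc; apply/funext => a; rewrite mulVKg.
Qed.

Local Notation E := (pointwise_space (G -> R) R).

(** A mean is a point of the product [R^(G -> R)], so that convergence on each function is the
    topology of the space. The value 0 off the bounded uniformly continuous functions confines every
    coordinate to a segment; the norm bound makes evaluations Lipschitz. *)
Let mean : set E := [set m | [/\
  forall h k, bounded_uc h -> bounded_uc k ->
    m (fun g => h g + k g) = m h + m k,
  forall h c, bounded_uc h -> (forall g, `|h g| <= c) -> `|m h| <= c,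
  forall h, ~ bounded_uc h -> m h = 0 &
  forall c, m (fun=> c) = c]].

(** Additivity turns the difference into the single value [m (h - k)]. The estimate is uniform in
    [m], as the joint continuity of the action requires. *)
Let mean_sub (m : E) h k c : mean m -> bounded_uc h -> bounded_uc k ->
  (forall g, `|h g - k g| <= c) -> `|m h - m k| <= c.
Proof.
move=> [mD mb _ mc] bh bk hk.
have := bounded_uc_lin (-1) bh bk.
under [X in bounded_uc X]eq_fun do rewrite mulN1r; move=> bhk.
have -> : m h = m (fun g => h g - k g) + m k.
  by rewrite -mD//; congr m; apply/funext => g; rewrite subrK.
by rewrite addrK; exact: mb.
Qed.

(** The means form a closed subset of a Tychonoff box, since each defining condition involves
    finitely many coordinates. *)
Let mean_compact : compact mean.
Proof.
(* [c h] is some bound of [|h|], with default 0 when there is none. *)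
pose c h : R := xget 0 [set M | forall g, `|h g| <= M].
have := @pointwise_compact _ R (fun h => if `[< bounded_uc h >] then c h else 0).
move=> /subclosed_compact; apply; last first.
  move=> m [_ mb m0 _] h /=; case: asboolP => [bh|/m0 ->]; last by rewrite normr0.
  by apply: mb => //; case: bh => -[M hM] _;
    apply: (@xgetPex _ 0 [set M | forall g, `|h g| <= M]); exists M.
have ev h : continuous (fun m : E => m h : R^o) by move=> m; exact: cvg_eval.
have -> : mean = 
  \bigcap_(p in [set p | bounded_uc p.1 /\ bounded_uc p.2])
    ((fun m : E => m (fun g => p.1 g + p.2 g) - (m p.1 + m p.2) : R^o) @^-1` [set 0]) `&`
  (\bigcap_(p in [set p : (G -> R) * R | bounded_uc p.1 /\ forall g, `|p.1 g| <= p.2])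
    ((fun m : E => `|m p.1| : R^o) @^-1` [set x | x <= p.2])) `&`
  (\bigcap_(h in [set h | ~ bounded_uc h]) ((fun m : E => m h : R^o) @^-1` [set 0])) `&`
  (\bigcap_(c in [set: R]) ((fun m : E => m (fun=> c) : R^o) @^-1` [set c])).
  apply/seteqP; split=> [m [mD mb m0 mc]|m [[[mD mb] m0] mc]].
    split; [split; [split|]|].
    - by move=> p [p1 p2] /=; rewrite mD// subrr.
    - by move=> p [p1 p2] /=; exact: mb.
    - by move=> h; exact: m0.
    - by move=> x _; exact: mc.
  split.
  - by move=> h k bh bk; apply/eqP; rewrite -subr_eq0; apply/eqP; exact: (mD (h, k)).
  - by move=> h x bh hx; exact: (mb (h, x)).
  - exact: m0.
  - by move=> x; exact: mc.
apply: closedI; [apply: closedI; [apply: closedI|]|]; apply: closed_bigI => p _.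
- have cp : continuous (fun m : E => m (fun g => p.1 g + p.2 g) - (m p.1 + m p.2) : R^o).
    move=> m; have h1 := ev (fun g => p.1 g + p.2 g) m.
    exact: (cvgB h1 (cvgD (ev p.1 m) (ev p.2 m))).
  by apply: preimage_closed (@closed_eq _ _) => m _; exact: cp.
- have cp : continuous (fun m : E => `|m p.1| : R^o).
    by move=> m; exact: (cvg_norm (ev p.1 m)).
  by apply: preimage_closed (@closed_le _ _) => m _; exact: cp.
- by apply: preimage_closed (@closed_eq _ _) => m _; exact: ev.
- by apply: preimage_closed (@closed_eq _ _) => m _; exact: ev.
Qed.

Let mean_convex : convex_set mean.
Proof.
move=> m n l; rewrite !inE => -[mD mb m0 mc] [nD nb n0 nc].
have lE h : (conv l m n : E) h = l%:num * m h + (1 - l%:num) * n h by [].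
split.
- by move=> h k bh bk; rewrite !lE mD// nD//; ring.
- move=> h c bh hc; rewrite lE (le_trans (ler_normD _ _))// !normrM.
  have l0 : 0 <= l%:num by [].
  have l1 : 0 <= 1 - l%:num by rewrite subr_ge0.
  rewrite (ger0_norm l0) (ger0_norm l1).
  have := mb _ _ bh hc; have := nb _ _ bh hc; nra.
- by move=> h bh; rewrite lE m0// n0// !mulr0 addr0.
- by move=> c; rewrite lE mc nc; ring.
Qed.

Let mean_nonempty : mean !=set0.
Proof.
(* Evaluation at the identity, cut off outside the uniformly continuous functions. *)
exists (fun h => if `[< bounded_uc h >] then h 1%g else 0); split.
- move=> h k bh bk; have := bounded_uc_lin 1 bh bk.
  under [X in bounded_uc X]eq_fun do rewrite mul1r.
  by move=> bhk; do 3 (case: asboolP => // _).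
- by move=> h c bh; case: asboolP.
- by move=> h bh; case: asboolP.
- by move=> c; case: asboolP => // -[]; exact: bounded_uc_cst.
Qed.

Let translate (g : G) (m : E) : E := fun h => m (fun a => h (g * a)%g).

Let translate_action : continuous_affine_action mean translate.
Proof.
split.
- move=> g m [mD mb m0 mc]; split => /=.
  + by move=> h k bh bk; apply: mD; exact: bounded_uc_translate.
  + by move=> h c bh hc; apply: mb => //; exact: bounded_uc_translate.
  + by move=> h bh; apply: m0; exact: bounded_uc_translateN.
  + by move=> c; exact: mc.
- by move=> m _; apply/funext => h; rewrite /translate; under eq_fun do rewrite mul1g.
- by move=> g g' m _; apply/funext => h; rewrite /translate;
  under eq_fun do rewrite -mulgA.
- by [].
- apply/subspace_continuousP => -[g m] /= mm; apply/cvg_pointwiseP => h.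
  apply/(@cvgrPdist_lt _ R^o) => e e0.
  change (nbhs (g, m) [set p | mean p.2 ->
    `|translate g m h - translate p.1 p.2 h| < e]).
  have [bh|bh] := pselect (bounded_uc h); last first.
    have [_ _ m0 _] := mm.
    apply: filterE => -[g' m'] [_ _ /= m'0 _]; rewrite /translate /=.
    rewrite m0; last exact: bounded_uc_translateN.
    by rewrite m'0 ?subrr ?normr0//; exact: bounded_uc_translateN.
  (* With [h_g a = h (g a)], the error is at most [|m h_g - m' h_g| + |m' h_g - m' h_g'|]. The first
     term is one coordinate of [m'] close to that of [m]; the second is small for all [m'] at once,
     because [g a] and [g' a] are as close as [g] and [g']. *)
  have e20 : 0 < e / 2 by rewrite divr_gt0.
  have [r r0 H] := bh.2 _ e20.
  have bg := bounded_uc_translate g bh.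
  exists (ball g r, [set n : E | `|m (fun a => h (g * a)%g) - n (fun a => h (g * a)%g)| < e / 2]).
    split; first exact: nbhsx_ballx.
    have := @cvg_eval _ _ m (fun a => h (g * a)%g).
    by move=> /(@cvgrPdist_lt _ R^o)/(_ _ e20).
  move=> -[g' m'] /= [gg' mm'] meanm'; rewrite /translate.
  rewrite Aut_ballE /= in gg'.
  have bg' := bounded_uc_translate g' bh.
  have : `|m' (fun a => h (g * a)%g) - m' (fun a => h (g' * a)%g)| <= e / 2.
    apply: mean_sub => // a; apply/ltW/H.
    by rewrite (le_lt_trans (Aut_dist_mul _ _ _ _))// Aut_distxx addr0.
  move=> H2; rewrite [e]splitr.
  rewrite -[X in `|X|](subrKA (m' (fun a => h (g * a)%g))).
  by rewrite (le_lt_trans (ler_normD _ _))// ltr_leD.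
Qed.

Lemma amenable_invariant_mean : amenable R G -> exists m : (G -> R) -> R, [/\
  forall h k, bounded_uc h -> bounded_uc k ->
    m (fun g => h g + k g) = m h + m k,
  forall c, m (fun=> c) = c &
  forall g h, m (fun a => h (g * a)%g) = m h].
Proof.
move=> am.
have [m [mD _ _ mc] mg] := am E mean translate (@pointwise_hausdorff _ _)
  mean_nonempty mean_compact mean_convex translate_action.
exists m; split => // g h.
by rewrite -[in RHS](mg g).
Qed.

End invariant_mean.

(** * Walsh functions *)

Section walsh.
Context (R : realType).
Implicit Types (v : nat -> bool) (F : {fset nat}).

Definition parity v F : bool := \big[addb/false]_(i <- F) v i.

(** The character of the compact group [(Z/2)^nat] indexed by [F]. *)
Definition walsh v F : R := (-1) ^+ parity v F.

Lemma parity0 v : parity v fset0 = false.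
Proof. by rewrite /parity big_seq_fset0. Qed.

(** The common part of [F] and [F'] is counted twice and cancels. *)
Lemma parityD v F F' :
  parity v F (+) parity v F' = parity v ((F `\` F') `|` (F' `\` F))%fset.
Proof.
rewrite /parity (big_fsetID _ (mem F') F) (big_fsetID _ (mem F) F').
rewrite (big_fsetID _ (mem F') ((F `\` F') `|` (F' `\` F))%fset) /=.
set a := \big[addb/false]_(i <- [fset x | x in F & x \in F']%fset) v i.
have -> : \big[addb/false]_(i <- [fset x | x in F' & x \in F]%fset) v i = a.
  by apply: congr_big => //; congr enum_fset; apply/fsetP => x; rewrite !inE /= andbC.
set b := \big[_/_]_(i <- _) _; set c := \big[_/_]_(i <- _) _.
set b' := \big[_/_]_(i <- _) _; set c' := \big[_/_]_(i <- _) _.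
have -> : b' = c.
  apply: congr_big => //; congr enum_fset; apply/fsetP => x; rewrite !inE /=.
  by case: (x \in F); case: (x \in F').
have -> : c' = b.
  apply: congr_big => //; congr enum_fset; apply/fsetP => x; rewrite !inE /=.
  by case: (x \in F); case: (x \in F').
by case: a b c => -[] [].
Qed.

Lemma walshM v F F' :
  walsh v F * walsh v F' = walsh v ((F `\` F') `|` (F' `\` F))%fset.
Proof. by rewrite /walsh -parityD signr_addb. Qed.

Lemma fset_symdiff0 F F' : ((F `\` F') `|` (F' `\` F) = fset0)%fset -> F = F'.
Proof.
move=> /fsetP H; apply/fsetP => x; have := H x; rewrite !inE.
by case: (x \in F); case: (x \in F').
Qed.

Lemma norm_walsh v F : `|walsh v F| = 1.
Proof. by rewrite /walsh normr_sign. Qed.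

Definition fset_of_ord n (F : {set 'I_n}) : {fset nat} := [fset val i | i in F]%fset.

Lemma fset_of_ord_inj n : injective (@fset_of_ord n).
Proof.
move=> F F' /fsetP H; apply/setP => i; have := H (val i).
by rewrite !(mem_imfset _ _ val_inj).
Qed.

Lemma walsh_prod v n (F : {set 'I_n}) :
  walsh v (fset_of_ord F) = \prod_(i in F) (-1) ^+ v i.
Proof.
rewrite /walsh /parity /fset_of_ord big_imfset /=; last by move=> ? ? _ _;
  exact: val_inj.
rewrite big_enum_cond /=.
rewrite (eq_bigl (fun i => i \in F)); last by move=> i; rewrite andbT.
apply: (@big_morph _ _ (fun b : bool => (-1) ^+ b : R)) => // a b.
by rewrite signr_addb.
Qed.

Lemma mkseq_codom v n : mkseq v n = [seq v (val i) | i <- enum 'I_n].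
Proof. by rewrite /mkseq -val_enum_ord -map_comp. Qed.

(** The sum over subsets factors into the product of the [1 + (-1)^(a i + v i)], which vanishes as
    soon as one digit differs: it is [2^n] times the Dirac function of the word [a]. *)
Lemma sum_walsh n (a : {ffun 'I_n -> bool}) v :
  \sum_(F : {set 'I_n}) (\prod_(i in F) (-1) ^+ a i) * walsh v (fset_of_ord F) =
  if a == [ffun i => v (val i)] then 2 ^+ n else 0.
Proof.
transitivity (\prod_(i < n) ((-1) ^+ (a i (+) v i) + 1 : R)).
  rewrite bigA_distr; apply: eq_big => // F _.
  rewrite walsh_prod -big_split /= big_mkcond /=; apply: eq_bigr => i _.
  by case: ifP => // _; rewrite signr_addb.
case: eqP => [->|av].
  rewrite (eq_bigr (fun=> 2)); last by move=> i _; rewrite ffunE addbb.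
  by rewrite prodr_const card_ord.
have [i avi] : exists i, a i != v (val i).
  apply/not_existsP => H; apply: av; apply/ffunP => i; rewrite ffunE.
  by apply/eqP/negP => /negP/H.
rewrite (bigD1 i) //= (_ : a i (+) v i = true) ?expr1 ?addNr ?mul0r//.
by rewrite -negb_eqb.
Qed.

(** Fourier inversion on [(Z/2)^n], by writing [phi] as a combination of Dirac functions. The
    coefficients are chosen before [v], so they serve for all points and all codings. *)
Lemma walsh_expansion n (phi : seq bool -> R) :
  exists a : {set 'I_n} -> R, forall v,
    phi (mkseq v n) = \sum_(F : {set 'I_n}) a F * walsh v (fset_of_ord F).
Proof.
exists (fun F : {set 'I_n} => \sum_(b : {ffun 'I_n -> bool})
  phi [seq b i | i <- enum 'I_n] / 2 ^+ n * \prod_(i in F) (-1) ^+ b i) => v.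
under eq_bigr do rewrite mulr_suml.
rewrite exchange_big /=.
under eq_bigr do under eq_bigr do rewrite -mulrA.
under eq_bigr do rewrite -mulr_sumr sum_walsh.
rewrite (bigD1 [ffun i => v (val i)]) //= eqxx big1 ?addr0; last first.
  by move=> b /negPf ->; rewrite mulr0.
rewrite mulfVK ?expf_neq0 ?pnatr_eq0// mkseq_codom; congr phi.
by apply: eq_map => i; rewrite ffunE.
Qed.

End walsh.

(** * Integration of bounded measurable functions *)

Section bounded_measurable.
Context (R : realType) (d : measure_display) (T : measurableType d).
Variable mu : {finite_measure set T -> \bar R}.
Implicit Types h k : T -> R.

Definition bounded_measurable h : Prop :=
  measurable_fun setT h /\ exists M, forall x, `|h x| <= M.

Lemma bounded_measurable_integrable h : bounded_measurable h ->
  mu.-integrable setT (EFin \o h).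
Proof.
move=> [mh [M hM]]; apply: measurable_bounded_integrable => //.
  by rewrite -ge0_fin_numE// fin_num_measure.
by exists M; split; [exact: num_real|move=> y /ltW My x _; exact: le_trans My].
Qed.

Lemma bounded_measurableD h k : bounded_measurable h -> bounded_measurable k ->
  bounded_measurable (fun x => h x + k x).
Proof.
move=> [mh [M hM]] [mk [N kN]]; split; first exact: measurable_funD.
by exists (M + N) => x; rewrite (le_trans (ler_normD _ _))// lerD.
Qed.

Lemma bounded_measurableM h k : bounded_measurable h -> bounded_measurable k ->
  bounded_measurable (fun x => h x * k x).
Proof.
move=> [mh [M hM]] [mk [N kN]]; split; first exact: measurable_funM.
by exists (M * N) => x; rewrite normrM ler_pM.
Qed.

Lemma bounded_measurable_cst c : bounded_measurable (fun=> c).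
Proof. by split => //; exists `|c|. Qed.

Lemma bounded_measurable_sum (I : Type) (s : seq I) (f : I -> T -> R) :
  (forall i, bounded_measurable (f i)) ->
  bounded_measurable (fun x => \sum_(i <- s) f i x).
Proof.
move=> bf; elim: s => [|i s ih].
  by under eq_fun do rewrite big_nil; exact: bounded_measurable_cst.
by under eq_fun do rewrite big_cons; exact: bounded_measurableD.
Qed.

Lemma bounded_measurable_indic (A : set T) : measurable A ->
  bounded_measurable (\1_A : T -> R).
Proof.
move=> mA; split; first exact: measurable_indic.
by exists 1 => x; rewrite indicE; case: (x \in A); rewrite /= ?normr1 ?normr0.
Qed.

Lemma RintegralD_bm h k : bounded_measurable h -> bounded_measurable k ->
  \int[mu]_x (h x + k x) = \int[mu]_x h x + \int[mu]_x k x.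
Proof.
by move=> bh bk; rewrite RintegralD//; exact: bounded_measurable_integrable.
Qed.

Lemma RintegralZ_bm c h : bounded_measurable h ->
  \int[mu]_x (c * h x) = c * \int[mu]_x h x.
Proof.
by move=> bh; rewrite RintegralZl//; exact: bounded_measurable_integrable.
Qed.

Lemma Rintegral_sum_bm (I : Type) (s : seq I) (f : I -> T -> R) :
  (forall i, bounded_measurable (f i)) ->
  \int[mu]_x (\sum_(i <- s) f i x) = \sum_(i <- s) \int[mu]_x f i x.
Proof.
move=> bf; elim: s => [|i s ih].
  rewrite big_nil; under eq_Rintegral do rewrite big_nil.
  by rewrite Rintegral_cst// mul0r.
rewrite big_cons -ih; under eq_Rintegral do rewrite big_cons.
by rewrite RintegralD_bm//; exact: bounded_measurable_sum.
Qed.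

Lemma Rintegral_indic (A : set T) : measurable A ->
  \int[mu]_x (\1_A x : R) = fine (mu A).
Proof. by move=> mA; rewrite /Rintegral integral_indic// setIT. Qed.

End bounded_measurable.

(** * Digit functions and their parity sets *)

Section digits.
Context (d : measure_display) (T : measurableType d).
Variable delta : T -> nat -> bool.

(** The set where the Walsh function of [F] equals -1. *)
Definition parity_set (F : {fset nat}) : set T := [set x | parity (delta x) F].

Definition measurable_digits : Prop := forall n, measurable [set x | delta x n].

Lemma measurable_parity_set F : measurable_digits -> measurable (parity_set F).
Proof.
rewrite /parity_set /parity => md.
elim: (enum_fset F) => [|i s ih].
  by rewrite [X in measurable X](_ : _ = set0)//; apply/seteqP; split=> x //=;
    rewrite big_nil.
rewrite [X in measurable X](_ : _ = [set x | delta x i] `+`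
    [set x | \big[addb/false]_(i <- s) delta x i]).
  by apply: measurableU; apply: measurableD.
apply/seteqP; split=> x /=; rewrite big_cons /setY /=.
  by case: (delta x i) => /= [/negP|]; [left|right].
by case: (delta x i) => /= -[] [? ?] //; apply/negP.
Qed.

End digits.

Section digits_measure.
Context (R : realType) (d : measure_display) (T : measurableType d).
Variables (mu : {measure set T -> \bar R}) (delta : T -> nat -> bool).

(** Every nonconstant Walsh function has integral zero; in other words, the digits are independent
    fair bits for the normalized measure. Doubling avoids a division in [\bar R]. *)
Definition balanced_digits : Prop := forall F, F != fset0 ->
  (mu (parity_set delta F) + mu (parity_set delta F) = mu setT)%E.

(** Sets depending on finitely many digits are dense in the measure algebra; this makes the Walsh
    system complete. *)
Definition dense_digits : Prop := forall B e, measurable B -> 0 < e ->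
  exists n (P : pred (seq bool)),
    (mu (B `+` [set x | P (mkseq (delta x) n)]) < e%:E)%E.

End digits_measure.

(** * Orthogonality of the Walsh functions and Bessel's inequality *)

Section fourier.
Context (R : realType) (d : measure_display) (T : measurableType d).
Variables (mu : {finite_measure set T -> \bar R}) (delta : T -> nat -> bool).
Hypothesis mdelta : measurable_digits delta.
Hypothesis bdelta : balanced_digits mu delta.
Hypothesis ddelta : dense_digits mu delta.
Hypothesis mu_gt0 : (0 < mu setT)%E.
Implicit Types (F : {fset nat}) (B C : set T).

Local Notation w F := (fun x => walsh R (delta x) F).
Local Notation M := (fine (mu setT)).
Local Notation "'m' B" := (fine (mu B)) (at level 10).

(** The integral of the Walsh function over [B]. Expressed by measures of sets only, it visibly
    ignores null sets and follows measure-preserving maps. *)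
Definition walsh_coef F B : R := m B - 2 * m (B `&` parity_set delta F).

Lemma walsh_indic F x : walsh R (delta x) F = 1 - 2 * \1_(parity_set delta F) x.
Proof.
rewrite indicE /walsh; case: (boolP (parity _ _)) => p.
  by rewrite mem_set// expr1 mulr1n; ring.
by rewrite memNset ?expr0 ?mulr0 ?subr0//; exact/negP.
Qed.

Lemma bounded_measurable_walsh F : bounded_measurable (w F).
Proof.
under eq_fun do rewrite walsh_indic.
split; last first.
  exists 1 => x; rewrite -walsh_indic norm_walsh//.
apply: measurable_funB => //; apply: measurable_funM => //.
by apply: measurable_indic; exact: measurable_parity_set.
Qed.

Lemma walsh_coefE F B : measurable B ->
  walsh_coef F B = \int[mu]_x (\1_B x * w F x).
Proof.
move=> mB; have mF := measurable_parity_set F mdelta.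
have b1 := bounded_measurable_indic R mB.
have b2 := bounded_measurable_indic R (measurableI _ _ mB mF).
under eq_Rintegral => x _.
  rewrite walsh_indic (_ : _ * _ = \1_B x + (- 2) * \1_(B `&` parity_set delta F) x);
    last first.
    by rewrite indicI /=; ring.
  over.
rewrite RintegralD_bm//; last exact: bounded_measurableM (bounded_measurable_cst _ _) _.
rewrite RintegralZ_bm// !Rintegral_indic//; first by rewrite /walsh_coef mulNr.
exact: measurableI.
Qed.

Lemma Rintegral_walsh F : \int[mu]_x w F x = if F == fset0 then M else 0.
Proof.
have mF := measurable_parity_set F mdelta.
have := walsh_coefE F measurableT; rewrite /walsh_coef setTI.
under eq_Rintegral do rewrite indicT mul1r.
move=> <-; case: eqP => [->|/eqP F0].
  rewrite (_ : parity_set _ _ = set0) ?measure0 ?mulr0 ?subr0//.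
  by apply/seteqP; split => x //=; rewrite /parity_set /= parity0.
by rewrite -(bdelta F0) fineD ?fin_num_measure//; ring.
Qed.

Lemma walsh_orthogonal F F' :
  \int[mu]_x (w F x * w F' x) = if F == F' then M else 0.
Proof.
under eq_Rintegral do rewrite walshM.
rewrite Rintegral_walsh; have [->|FF'] := eqVneq F F'.
  by rewrite fsetDv fsetU0 eqxx.
case: eqP => // /fset_symdiff0 FE.
by rewrite FE eqxx in FF'.
Qed.

Lemma fine_mu_gt0 : 0 < M.
Proof. by rewrite fine_gt0// mu_gt0 -ge0_fin_numE// fin_num_measure. Qed.

(** The Walsh functions have squared norm [M] instead of 1, whence the factor [M]. The orthogonal
    projection of [h] is [k / M]; the inequality is the positivity of the integral of [(M h - k)^2],
    divided by [M]. *)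
Lemma bessel h (s : seq {fset nat}) : uniq s -> bounded_measurable h ->
  \sum_(F <- s) (\int[mu]_x (h x * w F x)) ^+ 2 <= M * \int[mu]_x (h x ^+ 2).
Proof.
move=> us bh.
have bw := bounded_measurable_walsh.
set a := fun F => \int[mu]_x (h x * w F x).
pose k x := \sum_(F <- s) a F * w F x.
have bk : bounded_measurable k.
  by apply: bounded_measurable_sum => F;
    exact: bounded_measurableM (bounded_measurable_cst _ _) _.
have hk : \int[mu]_x (h x * k x) = \sum_(F <- s) a F ^+ 2.
  under eq_Rintegral => x _.
    rewrite mulr_sumr; under eq_bigr do rewrite mulrCA; over.
  rewrite Rintegral_sum_bm; last first.
    move=> F; apply: bounded_measurableM; first exact: bounded_measurable_cst.
    exact: bounded_measurableM.
  by apply: eq_bigr => F _; rewrite RintegralZ_bm ?expr2//; exact: bounded_measurableM.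
have kk : \int[mu]_x (k x * k x) = M * \sum_(F <- s) a F ^+ 2.
  under eq_Rintegral => x _.
    rewrite {1}/k mulr_suml; under eq_bigr do rewrite -mulrA; over.
  rewrite Rintegral_sum_bm; last first.
    move=> F; apply: bounded_measurableM; first exact: bounded_measurable_cst.
    exact: bounded_measurableM.
  rewrite mulr_sumr; apply: eq_big_seq => F Fs.
  rewrite RintegralZ_bm; last exact: bounded_measurableM.
  under eq_Rintegral => x _.
    rewrite /k mulr_sumr; under eq_bigr do rewrite mulrCA; over.
  rewrite Rintegral_sum_bm; last first.
    move=> F'; apply: bounded_measurableM; first exact: bounded_measurable_cst.
    exact: bounded_measurableM.
  rewrite (bigD1_seq F)//= big1 ?addr0; last first.
    move=> F' F'F; rewrite RintegralZ_bm ?walsh_orthogonal;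
      last exact: bounded_measurableM.
    by rewrite eq_sym (negPf F'F) mulr0.
  rewrite RintegralZ_bm ?walsh_orthogonal ?eqxx; last exact: bounded_measurableM.
  by ring.
have : 0 <= \int[mu]_x (M ^+ 2 * (h x ^+ 2) + ((- 2 * M) * (h x * k x) + k x * k x)).
  apply: Rintegral_ge0 => x _.
  rewrite (_ : _ + _ = (M * h x - k x) ^+ 2) ?sqr_ge0//; by ring.
have bh2 : bounded_measurable (fun x => h x ^+ 2).
  by under eq_fun do rewrite expr2; exact: bounded_measurableM.
rewrite RintegralD_bm; last 2 first.
- by apply: bounded_measurableM => //; exact: bounded_measurable_cst.
- apply: bounded_measurableD; last exact: bounded_measurableM.
  by apply: bounded_measurableM;
    [exact: bounded_measurable_cst|exact: bounded_measurableM].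
rewrite RintegralD_bm; last 2 first.
- by apply: bounded_measurableM;
  [exact: bounded_measurable_cst|exact: bounded_measurableM].
- exact: bounded_measurableM.
rewrite !RintegralZ_bm ?hk ?kk//; last exact: bounded_measurableM.
move=> H; have M0 := fine_mu_gt0; rewrite -(ler_pM2l M0).
set S := \sum_(F <- s) _ in H *; set I := \int[mu]_x _ in H *.
by nra.
Qed.

End fourier.

(** * Weighted Walsh energy of a set *)

Section esum_fin.
Context (R : realType) (I : choiceType).
Implicit Types a : I -> R.

Lemma esum_le_fin a (b : R) :
  (forall s, uniq s -> \sum_(i <- s) a i <= b) ->
  (\esum_(i in setT) (a i)%:E <= b%:E)%E.
Proof.
move=> H; apply: ge_ereal_sup => _ [X [finX _] <-].
by rewrite fsbig_finite// sumEFin lee_fin; apply: H.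
Qed.

Lemma sum_le_esum a (s : seq I) : uniq s ->
  ((\sum_(i <- s) a i)%:E <= \esum_(i in setT) (a i)%:E)%E.
Proof.
move=> us; apply: esum_ge; exists [set` s]; first by split.
by rewrite -fsbig_seq// sumEFin.
Qed.

End esum_fin.

Lemma measure_ae_eq (R : realType) (d : measure_display) (T : measurableType d)
    (mu : {measure set T -> \bar R}) (A B : set T) :
  measurable A -> measurable B -> (\forall x \ae mu, A x <-> B x) -> mu A = mu B.
Proof.
move=> mA mB [N [mN N0 AB]].
have DN X : measurable X -> mu X = mu (X `\` N).
  move=> mX; rewrite (measureDI mu mX mN) [X in (_ + X)%E](_ : _ = 0%E) ?adde0//.
  by apply/eqP; rewrite eq_le measure_ge0 andbT -N0 le_measure// inE//;
    exact: measurableI.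
rewrite DN// [RHS]DN//; congr (mu _).
have H x : ~ N x -> (A x <-> B x) by move=> nNx; apply: contrapT => /AB.
by apply/seteqP; split=> x [Ax nNx]; split => //; apply/H.
Qed.

Section weight.
Context (R : realType).
Implicit Types (U : pred nat) (F : {fset nat}).

(** The proportion of [F] that lies in [U]. For the empty set the quotient is 0 by convention, so
    the weight drops the constant coefficient. *)
Definition weight U F : R := (\sum_(i <- F) (U i : nat))%:R / #|` F|%:R.

Lemma weight_ge0 U F : 0 <= weight U F.
Proof. by rewrite divr_ge0. Qed.

Lemma sum_card F : (\sum_(i <- F) 1 = #|` F|)%N.
Proof. by rewrite sum1_size. Qed.

Lemma weight_le1 U F : weight U F <= 1.
Proof.
rewrite /weight; have [->|F0] := eqVneq F fset0.
  by rewrite cardfs0 invr0 mulr0.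
rewrite ler_pdivrMr ?mul1r ?ltr0n ?cardfs_gt0// ler_nat -sum_card.
by apply: leq_sum => i _; case: (U i).
Qed.

(** The hypothesis says through 0-1 values that [V] is the disjoint union of [U] and [U']. *)
Lemma weightD (U U' V : pred nat) F : (forall i, (U i + U' i = V i :> nat)%N) ->
  weight U F + weight U' F = weight V F.
Proof.
move=> UV; rewrite /weight -mulrDl -natrD -big_split /=.
by congr (_%:R / _); apply: eq_bigr => i _; rewrite -UV.
Qed.

Lemma weightT F : weight predT F = (F != fset0)%:R.
Proof.
rewrite /weight sum_card; have [->|F0] := eqVneq F fset0.
  by rewrite cardfs0 invr0 mulr0.
by rewrite divff// pnatr_eq0 -lt0n cardfs_gt0.
Qed.

Lemma weight_imfset U F (pi : nat -> nat) : injective pi ->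
  weight U (pi @` F)%fset = weight (U \o pi) F.
Proof.
move=> pi_inj; rewrite /weight card_imfset// big_imfset//=.
by move=> ? ? _ _; exact: pi_inj.
Qed.

End weight.

Section energy.
Context (R : realType) (d : measure_display) (T : measurableType d).
Variables (mu : {finite_measure set T -> \bar R}) (delta : T -> nat -> bool).
Hypothesis mdelta : measurable_digits delta.
Hypothesis bdelta : balanced_digits mu delta.
Hypothesis ddelta : dense_digits mu delta.
Hypothesis mu_gt0 : (0 < mu setT)%E.
Implicit Types (F : {fset nat}) (B C : set T) (theta : {fset nat} -> R).

Local Notation w F := (fun x => walsh R (delta x) F).
Local Notation M := (fine (mu setT)).
Local Notation "'m' B" := (fine (mu B)) (at level 10).
Local Notation coef := (walsh_coef mu delta).

Lemma bessel_set B (s : seq {fset nat}) : uniq s -> measurable B ->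
  \sum_(F <- s) coef F B ^+ 2 <= M * m B.
Proof.
move=> us mB; under eq_bigr do rewrite walsh_coefE//.
rewrite (le_trans (bessel _ _ _ us _))//; first exact: bounded_measurable_indic.
under eq_Rintegral => x _.
  rewrite (_ : _ ^+ 2 = \1_B x); last by rewrite indicE; case: (x \in B);
    rewrite ?expr1n ?expr0n.
  over.
by rewrite Rintegral_indic.
Qed.

(** Bessel's inequality for the difference of the two indicators, whose square is the indicator of
    the symmetric difference. *)
Lemma bessel_setY B C (s : seq {fset nat}) : uniq s -> measurable B -> measurable C ->
  \sum_(F <- s) (coef F B - coef F C) ^+ 2 <= M * m (B `+` C).
Proof.
move=> us mB mC.
have bw F := bounded_measurable_walsh R mdelta F.
have bB := bounded_measurable_indic R mB; have bC := bounded_measurable_indic R mC.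
have mBC : measurable (B `+` C) by apply: measurableU; exact: measurableD.
have bh : bounded_measurable (fun x => \1_B x + (-1) * \1_C x : R).
  by apply: bounded_measurableD => //; apply: bounded_measurableM => //;
    exact: bounded_measurable_cst.
rewrite (eq_bigr (fun F => (\int[mu]_x ((\1_B x + (-1) * \1_C x) * w F x)) ^+ 2));
  last first.
  move=> F _; under eq_Rintegral do rewrite mulrDl -mulrA.
  rewrite RintegralD_bm; last 2 first.
    - exact: bounded_measurableM.
    - by apply: bounded_measurableM;
      [exact: bounded_measurable_cst|exact: bounded_measurableM].
  by rewrite RintegralZ_bm ?mulN1r -?walsh_coefE//; exact: bounded_measurableM.
rewrite (le_trans (bessel _ _ _ us _))//.
under eq_Rintegral => x _.
  rewrite (_ : _ ^+ 2 = \1_(B `+` C) x); last first.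
    rewrite !indicE; have [xB|xB] := boolP (x \in B); have [xC|xC] := boolP (x \in C).
    - rewrite memNset; first by rewrite mulN1r subrr expr0n.
      by move: xB xC; rewrite !inE => ? ? -[] [].
    - rewrite mem_set; first by rewrite mulr0 addr0 expr1n.
      by move: xB xC; rewrite !inE notin_setE => ? ?; left.
    - rewrite mem_set; first by rewrite add0r mulN1r sqrrN expr1n.
      by move: xB xC; rewrite !inE notin_setE => ? ?; right.
    - rewrite memNset; first by rewrite mulr0 addr0 expr0n.
      by move: xB xC; rewrite !notin_setE => ? ? -[] [].
  over.
by rewrite Rintegral_indic.
Qed.

Lemma fine_measureD B C : measurable B -> measurable C ->
  m B = m (B `&` C) + m (B `\` C).
Proof.
move=> mB mC; rewrite (measureDI mu mB mC) addrC fineD// fin_num_measure//.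
  exact: measurableI.
exact: measurableD.
Qed.

Lemma fine_measureY B C : measurable B -> measurable C ->
  m (B `+` C) = m (B `\` C) + m (C `\` B).
Proof.
move=> mB mC; rewrite measureU; last 3 first.
- exact: measurableD.
- exact: measurableD.
- by apply/seteqP; split=> x // [[? ?] []].
by rewrite fineD// fin_num_measure//; exact: measurableD.
Qed.

(** Let [C] be a cylinder close to [B] and [a F] the coordinates of its indicator. The positivity of
    the sum of the [(coef F B - M a F)^2] bounds the sum of the [coef F B ^ 2] from below by
    [2 M m (B & C) - M m C], which is [M m B] minus [M] times the measure of the symmetric
    difference. This explains the tolerance [e / M]. *)
Lemma parseval_lower B e : measurable B -> 0 < e ->
  exists2 s : seq {fset nat}, uniq s &
    M * m B - e <= \sum_(F <- s) coef F B ^+ 2.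
Proof.
move=> mB e0; have M0 := fine_mu_gt0 mu_gt0.
have [n [P BC]] := ddelta mB (divr_gt0 e0 M0).
set C := [set x | _] in BC.
have [a aE] := walsh_expansion n (fun b => (P b)%:R : R).
pose f (F : {set 'I_n}) := fset_of_ord F.
have bw F := bounded_measurable_walsh R mdelta F.
have indC x : \1_C x = \sum_(F : {set 'I_n}) a F * w (f F) x.
  by rewrite -aE indicE; congr (_%:R); congr (nat_of_bool _); apply/idP/idP;
    rewrite inE.
have bterm (F : {set 'I_n}) : bounded_measurable (fun x => a F * w (f F) x).
  by apply: bounded_measurableM; [exact: bounded_measurable_cst|].
have bC : bounded_measurable (\1_C : T -> R).
  rewrite (_ : \1_C = fun x => \sum_(F : {set 'I_n}) a F * w (f F) x);
    last exact/funext.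
  exact: bounded_measurable_sum.
have mC : measurable C by apply/measurable_indicP; exact: bC.1.
have mBC : measurable (B `&` C) by exact: measurableI.
have bB := bounded_measurable_indic R mB.
have H1 : \sum_(F : {set 'I_n}) a F * coef (f F) B = m (B `&` C).
  rewrite -(Rintegral_indic _ mBC).
  under [RHS]eq_Rintegral => x _.
    rewrite indicI /= indC mulr_sumr; under eq_bigr do rewrite mulrCA; over.
  rewrite Rintegral_sum_bm; last first.
    by move=> F; apply: bounded_measurableM;
      [exact: bounded_measurable_cst|exact: bounded_measurableM].
  by apply: eq_bigr => F _; rewrite RintegralZ_bm ?walsh_coefE//;
    exact: bounded_measurableM.
have H2 : M * \sum_(F : {set 'I_n}) a F ^+ 2 = m C.
  rewrite -(Rintegral_indic _ mC).
  under [RHS]eq_Rintegral => x _.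
    rewrite (_ : \1_C x = \1_C x * \1_C x); last by rewrite indicE; case: (x \in C);
      rewrite ?mulr1 ?mulr0.
    rewrite {2}indC mulr_sumr; under eq_bigr do rewrite mulrCA; over.
  rewrite Rintegral_sum_bm; last first.
    by move=> F; apply: bounded_measurableM;
      [exact: bounded_measurable_cst|exact: bounded_measurableM].
  rewrite mulr_sumr; apply: eq_bigr => F _; rewrite RintegralZ_bm;
    last exact: bounded_measurableM.
  under eq_Rintegral => x _.
    rewrite indC mulr_suml; under eq_bigr do rewrite -mulrA; over.
  rewrite Rintegral_sum_bm; last first.
    by move=> F'; apply: bounded_measurableM;
      [exact: bounded_measurable_cst|exact: bounded_measurableM].
  rewrite (bigD1 F)//= big1 ?addr0; last first.
    move=> F' F'F; rewrite RintegralZ_bm ?(walsh_orthogonal mdelta bdelta);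
      last exact: bounded_measurableM.
    rewrite (_ : f F' == f F = false) ?mulr0//.
    by apply/negbTE; apply: contra F'F => /eqP /fset_of_ord_inj ->.
  rewrite RintegralZ_bm ?(walsh_orthogonal mdelta bdelta) ?eqxx;
    last exact: bounded_measurableM.
  by ring.
exists (map f (index_enum {set 'I_n})).
  by rewrite map_inj_uniq ?index_enum_uniq//; exact: fset_of_ord_inj.
rewrite big_map.
have : 0 <= \sum_(F : {set 'I_n}) (coef (f F) B - M * a F) ^+ 2.
  by apply: sumr_ge0 => F _; exact: sqr_ge0.
rewrite (eq_bigr (fun F : {set 'I_n} => coef (f F) B ^+ 2 + (- 2 * M) * (a F * coef (f F) B) +
    M ^+ 2 * a F ^+ 2)); last by move=> F _; ring.
have H3 : M ^+ 2 * (\sum_(F : {set 'I_n}) a F ^+ 2) = M * m C by rewrite expr2 -mulrA H2.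
rewrite !big_split /= -!mulr_sumr H1 H3.
have := fine_measureD mB mC; have := fine_measureD mC mB; rewrite (setIC C B).
have : m (B `+` C) < e / M.
  rewrite -lte_fin fineK// fin_num_measure//.
  by apply: measurableU; exact: measurableD.
rewrite fine_measureY// ltr_pdivlMr//.
move: (\sum_F _) => S.
by nra.
Qed.

(** An extended sum of nonnegative terms can be reindexed and added without summability conditions;
    finiteness comes afterwards from Bessel's inequality. *)
Definition energy theta B : \bar R :=
  (\esum_(F in setT) (theta F * coef F B ^+ 2)%:E)%E.

Definition is_weight theta := forall F, 0 <= theta F <= 1.

Lemma energy_ge0 theta B : is_weight theta -> (0 <= energy theta B)%E.
Proof.
move=> th; apply: esum_ge0 => F _; rewrite lee_fin mulr_ge0 ?sqr_ge0//.
by have /andP[] := th F.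
Qed.

Lemma energy_le theta B : measurable B -> is_weight theta ->
  (energy theta B <= (M * m B)%:E)%E.
Proof.
move=> mB th; apply: esum_le_fin => s us; rewrite (le_trans _ (bessel_set us mB))//.
apply: ler_sum => F _; rewrite ler_piMl ?sqr_ge0//.
by have /andP[] := th F.
Qed.

Lemma energy_fin theta B : measurable B -> is_weight theta ->
  energy theta B \is a fin_num.
Proof.
move=> mB th; rewrite ge0_fin_numE ?energy_ge0//.
by apply: le_lt_trans (energy_le mB th) _; rewrite ltry.
Qed.

Lemma energyD theta theta' B : is_weight theta -> is_weight theta' ->
  energy (fun F => theta F + theta' F) B = (energy theta B + energy theta' B)%E.
Proof.
move=> th th'; rewrite /energy -esumD.
- by apply: eq_esum => F _; rewrite -EFinD mulrDl.
- by move=> F _; rewrite lee_fin mulr_ge0 ?sqr_ge0//; have /andP[] := th F.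
- by move=> F _; rewrite lee_fin mulr_ge0 ?sqr_ge0//; have /andP[] := th' F.
Qed.

Lemma parseval B : measurable B -> energy (fun=> 1) B = (M * m B)%:E.
Proof.
move=> mB; have w1 : is_weight (fun=> 1) by move=> F; rewrite ler01 lexx.
apply/eqP; rewrite eq_le energy_le//= -(fineK (energy_fin mB w1)) lee_fin.
apply/ler_addgt0Pr => e e0.
have [s us H] := parseval_lower mB e0.
rewrite -lerBlDr (le_trans H)// -lee_fin fineK ?energy_fin//.
apply: le_trans (sum_le_esum _ us); rewrite lee_fin.
by apply: ler_sum => F _; rewrite mul1r.
Qed.

(** The full weight is 1 minus the indicator of the empty set, whose coefficient is [m B]: Parseval
    minus one square. The value depends on [B] only through its measure. *)
Lemma energy_weightT B : measurable B ->
  energy (weight R predT) B = (M * m B - (m B) ^+ 2)%:E.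
Proof.
move=> mB.
have wT : is_weight (weight R predT) by move=> F; rewrite weight_ge0 weight_le1.
have w0 : is_weight (fun F => (F == fset0)%:R : R) by move=> F; case: eqP;
  rewrite lexx ler01.
have E0 : energy (fun F => (F == fset0)%:R) B = ((m B) ^+ 2)%:E.
  have c0 : coef fset0 B = m B.
    rewrite /walsh_coef (_ : B `&` _ = set0) ?measure0 ?mulr0 ?subr0//.
    by apply/seteqP; split=> x // -[_]; rewrite /parity_set /= parity0.
  apply/eqP; rewrite eq_le; apply/andP; split; last first.
    have := @sum_le_esum R _ (fun F => (F == fset0)%:R * coef F B ^+ 2) [:: fset0] isT.
    by rewrite big_seq1 eqxx mul1r c0.
  apply: esum_le_fin => s us; have [s0|s0] := boolP (fset0 \in s).
    rewrite (bigD1_seq _ s0 us) eqxx mul1r c0 big1 /= ?addr0//.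
    by move=> F /negPf ->; rewrite mul0r.
  rewrite big_seq big1 ?sqr_ge0// => F Fs; rewrite (_ : F == fset0 = false) ?mul0r//.
  by apply/negbTE; apply: contra s0 => /eqP <-.
have := energyD B wT w0.
have -> : energy (fun F => weight R predT F + (F == fset0)%:R) B = (M * m B)%:E.
  rewrite -parseval//; congr energy; apply/funext => F.
  by rewrite weightT; case: eqP; rewrite ?addr0 ?add0r.
rewrite E0 -(fineK (energy_fin mB wT)) -EFinD => -[->].
by rewrite addrK.
Qed.

(** The energy is quadratic in the coefficients, so a free parameter [t] splits the error: [t] times
    the energy of [C], at most [t M^2], and [1 + 1/t] times the Bessel bound for the difference. *)
Lemma energy_lip theta B C t : measurable B -> measurable C -> is_weight theta ->
  0 < t ->
  fine (energy theta B) <= fine (energy theta C) + t * M ^+ 2 + (1 + t^-1) * (M * m (B `+` C)).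
Proof.
move=> mB mC th t0; rewrite -lee_fin fineK ?energy_fin//.
apply: esum_le_fin => s us.
have H1 : \sum_(F <- s) theta F * coef F C ^+ 2 <= fine (energy theta C).
  by rewrite -lee_fin fineK ?energy_fin//; exact: sum_le_esum.
have M0 := fine_mu_gt0 mu_gt0.
have H2 : \sum_(F <- s) theta F * coef F C ^+ 2 <= M ^+ 2.
  apply: (le_trans H1); rewrite -lee_fin fineK ?energy_fin//.
  apply: (le_trans (energy_le mC th));
    rewrite lee_fin expr2 ler_pM2l// fine_le ?fin_num_measure//.
  by rewrite le_measure ?inE.
have H3 := bessel_setY us mB mC.
have : \sum_(F <- s) theta F * coef F B ^+ 2 <=
    (1 + t) * (\sum_(F <- s) theta F * coef F C ^+ 2) +
    (1 + t^-1) * (\sum_(F <- s) (coef F B - coef F C) ^+ 2).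
  rewrite !mulr_sumr -big_split /=; apply: ler_sum => F _.
  have /andP[th0 th1] := th F.
  move: (coef F B) (coef F C) (theta F) th0 th1 => x y q q0 q1.
  have tV : 0 < t^-1 by rewrite invr_gt0.
  (* Young: 2 y (x - y) <= t y^2 + (x - y)^2 / t *)
  have key : x ^+ 2 <= (1 + t) * y ^+ 2 + (1 + t^-1) * (x - y) ^+ 2.
    have tE : t^-1 * t = 1 by rewrite mulVf// gt_eqF.
    have : 0 <= t^-1 * (t * y - (x - y)) ^+ 2 by rewrite mulr_ge0 ?sqr_ge0// ltW.
    have -> : t^-1 * (t * y - (x - y)) ^+ 2 =
      (t^-1 * t) * (t * y ^+ 2 - 2 * y * (x - y)) + t^-1 * (x - y) ^+ 2 by ring.
    by rewrite tE mul1r => ?; nra.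
  apply: (le_trans (ler_wpM2l q0 key)); rewrite mulrDr mulrCA lerD2l.
  by rewrite ler_piMl// mulr_ge0 ?sqr_ge0// addr_ge0// ltW.
move=> H; apply: (le_trans H); rewrite mulrDl mul1r lerD ?lerD ?ler_pM2l//.
by rewrite ltr_wpDr// ?invr_ge0 ?ltr01// ltW.
Qed.

Lemma energy_uc theta e : is_weight theta -> 0 < e ->
  exists2 r, 0 < r & forall B C, measurable B -> measurable C -> m (B `+` C) < r ->
    `|fine (energy theta B) - fine (energy theta C)| < e.
Proof.
move=> th e0; have M0 := fine_mu_gt0 mu_gt0.
(* With this [t] the first error term of [energy_lip] is [e / 2]; the radius below keeps the second
   one under [e / 2]. *)
pose t := e / 2 / M ^+ 2.
have t0 : 0 < t by rewrite !divr_gt0// exprn_gt0.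
have q0 : 0 < (1 + t^-1) * M by rewrite mulr_gt0// addr_gt0// invr_gt0.
exists (e / 2 / ((1 + t^-1) * M)); first by rewrite !divr_gt0.
move=> B C mB mC; rewrite ltr_pdivlMr// => BC.
have tM : t * M ^+ 2 = e / 2 by rewrite mulfVK// expf_neq0// gt_eqF.
have H1 := energy_lip mB mC th t0.
have := energy_lip mC mB th t0; rewrite setYC => H2.
rewrite tM in H1 H2; rewrite mulrA mulrC in BC.
move: H1 H2; rewrite mulrA [_ * m (B `+` C)]mulrC => H1 H2.
rewrite ltr_norml; apply/andP; split; lra.
Qed.

Lemma energy_ae theta B C : measurable B -> measurable C ->
  (\forall x \ae mu, B x <-> C x) -> energy theta B = energy theta C.
Proof.
move=> mB mC BC; apply: eq_esum => F _; congr (_ * _ ^+ 2)%:E.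
rewrite /walsh_coef (measure_ae_eq mB mC BC); congr (_ - 2 * fine _).
have mF := measurable_parity_set F mdelta.
apply: measure_ae_eq; [exact: measurableI|exact: measurableI|].
by apply: filterS BC => x BC; split=> -[/BC].
Qed.

(** Up to a null set [phi] pulls the parity set of [F] back to that of [pi F], so the coefficient of
    the preimage of [B] at [pi F] is that of [B] at [F]. Reindexing by the bijection [F -> pi F]
    moves [pi] into the weight. *)
Lemma energy_preimage (pi : nat -> nat) (phi : T -> T) U B : involutive pi ->
  measurable_fun setT phi ->
  (forall A, measurable A -> mu (phi @^-1` A) = mu A) ->
  (\forall x \ae mu, forall n, delta (phi x) n = delta x (pi n)) ->
  measurable B ->
  energy (weight R U) (phi @^-1` B) = energy (weight R (U \o pi)) B.
Proof.
move=> piK mphi pphi dphi mB; have pi_inj := inv_inj piK.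
have mpre A : measurable A -> measurable (phi @^-1` A).
  by move=> mA; rewrite -[X in measurable X]setTI; exact: mphi.
rewrite /energy (reindex_esum setT setT (fun F : {fset nat} => (pi @` F)%fset));
  last first.
  have K : cancel (fun F : {fset nat} => (pi @` F)%fset) (fun F => (pi @` F)%fset).
    move=> F; rewrite -imfset_comp/=; apply/fsetP => x; apply/imfsetP/idP => /=.
      by move=> [y yF ->]; rewrite piK.
    by move=> xF; exists x; rewrite //= piK.
  split=> // [F F' _ _|F _]; first exact: (can_inj K).
  by exists (pi @` F)%fset.
apply: eq_esum => F _; rewrite weight_imfset//; congr (_ * _ ^+ 2)%:E.
rewrite /walsh_coef pphi//; congr (_ - 2 * fine _).
have mF := measurable_parity_set F mdelta.
rewrite -(pphi (B `&` _)); last exact: measurableI.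
apply: measure_ae_eq.
- by apply: measurableI; [exact: mpre|exact: measurable_parity_set].
- by apply: mpre; exact: measurableI.
apply: filterS dphi => x dphi; rewrite /parity_set /= /parity big_imfset /=; last first.
  by move=> ? ? _ _; exact: pi_inj.
by under [in X in _ <-> _ /\ X]eq_bigr do rewrite dphi.
Qed.

End energy.

(** * The paradoxical decomposition *)

Section coding.
Context (R : realType) (d : measure_display) (T : measurableType d).
Variable mu : {measure set T -> \bar R}.

(** [phi] is an involution everywhere, hence a measure-preserving bijection with itself as inverse,
    whereas the digits are permuted only almost everywhere; a null set of bad points can thus be
    fixed by [phi]. *)
Definition exchangeable_digits (delta : T -> nat -> bool) : Prop :=
  forall pi : nat -> nat, involutive pi -> exists phi : T -> T, [/\ involutive phi,
    measurable_fun setT phi,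
    forall A, measurable A -> mu (phi @^-1` A) = mu A &
    \forall x \ae mu, forall n, delta (phi x) n = delta x (pi n)].

Definition binary_coding (delta : T -> nat -> bool) : Prop :=
  [/\ measurable_digits delta, balanced_digits mu delta, dense_digits mu delta &
      exchangeable_digits delta].

End coding.

Section paradox.

Definition swap_parity (n : nat) : nat := if odd n then n.-1 else n.+1.

Lemma swap_parityK : involutive swap_parity.
Proof.
move=> n; rewrite {2}/swap_parity; case: ifPn => nodd; rewrite /swap_parity.
  by rewrite ifF; lia.
by rewrite ifT; lia.
Qed.

(* For r = 1, 3: exchanges 2 k and 4 k + r, and fixes the other odd numbers. *)
Definition swap_mod4 (r n : nat) : nat :=
  if ~~ odd n then (n.*2 + r)%N else if (n %% 4 == r)%N then ((n - r)./2)%N else n.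

Lemma swap_mod4K r : odd r -> (r < 4)%N -> involutive (swap_mod4 r).
Proof.
move=> rodd r4 n; rewrite {2}/swap_mod4; case: ifPn => n0.
  by rewrite /swap_mod4 ifF ?ifT; lia.
case: ifPn => n1; first by rewrite /swap_mod4 ifT; lia.
by rewrite /swap_mod4 (negPf n0) (negPf n1).
Qed.

Lemma even_swap_mod4 r n : odd r -> (r < 4)%N ->
  ~~ odd (swap_mod4 r n) = (n %% 4 == r)%N.
Proof.
by move=> rodd r4; rewrite /swap_mod4; case: ifPn => n0; [|case: ifPn => n1]; lia.
Qed.

End paradox.

(** * A binary coding contradicts amenability *)

Section nonamenable.
Context (R : realType) (d : measure_display) (T : measurableType d).
Variables (mu : {finite_measure set T -> \bar R}) (delta : T -> nat -> bool).
Hypothesis mu_gt0 : (0 < mu setT)%E.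
Hypothesis coding : binary_coding mu delta.

Let mdelta : measurable_digits delta. Proof. by case: coding. Qed.
Let bdelta : balanced_digits mu delta. Proof. by case: coding. Qed.
Let ddelta : dense_digits mu delta. Proof. by case: coding. Qed.
Let edelta : exchangeable_digits mu delta. Proof. by case: coding. Qed.

Local Notation M := (fine (mu setT)).

Let A : set T := [set x | delta x 0%N].

(** The set [a A], as the preimage of [A] under the inverse. Another representative of [a] changes
    it by a null set. *)
Let translate (a : Aut mu) : set T := mp_inv (repr a) @^-1` A.

Let translate_measurable a : measurable (translate a).
Proof. by rewrite -[X in measurable X]setTI; apply: mp_inv_measurable => //;
  exact: mdelta. Qed.

Let mu_translate a : mu (translate a) = mu A.
Proof. exact: (mp_preserving (mp_inverse (repr a)) (mdelta 0%N)). Qed.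

Let is_weight_weight U : is_weight (weight R U).
Proof. by move=> F; rewrite weight_ge0 weight_le1. Qed.

Let f U (a : Aut mu) : R := fine (energy mu delta (weight R U) (translate a)).

(** The symmetric difference of [a A] and [b A] lies in the set where the inverses of [a] and [b]
    disagree, of outer measure at most the distance of [a] and [b]. *)
Let f_bounded_uc U : bounded_uc (f U).
Proof.
have eM a : f U a <= M * M.
  have mt := translate_measurable a.
  rewrite /f -lee_fin fineK; last exact: energy_fin.
  apply: le_trans (energy_le mdelta bdelta mu_gt0 mt (is_weight_weight U)) _.
  rewrite lee_fin ler_pM2l ?fine_mu_gt0// fine_le ?fin_num_measure//.
  by apply: le_measure; rewrite ?inE.
split.
  exists (M * M) => a; rewrite ger0_norm//.
  by apply: fine_ge0; exact: energy_ge0.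
move=> e e0; have [r r0 H] := energy_uc mdelta bdelta mu_gt0 (is_weight_weight U) e0.
exists r => // a b ab; apply: H;
  [exact: translate_measurable|exact: translate_measurable|].
apply: le_lt_trans ab; rewrite /Aut_dist.
apply: le_trans (mp_dist_inverse _ _).
have mY : measurable (translate a `+` translate b).
  by apply: measurableU; apply: measurableD; exact: translate_measurable.
rewrite /mp_dist -measurable_mu_extE// fine_le ?mu_ext_fin_num//.
apply: le_mu_ext => x; rewrite /translate /setY /=.
by move=> [[ax bx]|[bx ax]] xx; [apply: bx; rewrite -xx|apply: ax; rewrite xx].
Qed.

(** Since [phi] is its own inverse, [phi (a A)] is the preimage of [a A] under [phi], to which
    [energy_preimage] applies. *)
Let f_translate (pi : nat -> nat) U : involutive pi ->
  exists g : Aut mu, forall a, f U (g * a)%g = f (U \o pi) a.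
Proof.
move=> piK; have [phi [phiK mphi pphi dphi]] := edelta piK.
pose h : mp_bijection mu := MpBijection phiK phiK mphi mphi pphi.
exists (\pi_(Aut mu)%qT h) => a; rewrite /f; congr fine.
rewrite -(energy_preimage mdelta _ piK mphi pphi dphi);
  last exact: translate_measurable.
apply: (energy_ae mdelta); first exact: translate_measurable.
  by rewrite -[X in measurable X]setTI;
    exact: (mphi measurableT _ (translate_measurable a)).
(* The chosen representative of the product agrees with the composition only almost everywhere;
   [energy_ae] absorbs the difference. *)
have ga : (\pi_(Aut mu)%qT h * a)%g = (\pi_(Aut mu)%qT (mp_comp h (repr a))).
  by rewrite -[in LHS](reprK a) [LHS]Aut_mul_pi.
have : mp_dist (mp_inverse (repr (\pi_(Aut mu)%qT h * a)%g)) (mp_inverse (mp_comp h (repr a))) = 0.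
  apply/eqP; rewrite eq_le mp_dist_ge0 andbT.
  by rewrite (le_trans (mp_dist_inverse _ _))// ga mp_dist_repr.
move=> /mp_dist0P/mp_ae_eqP; apply: filterS => x /= xx.
by rewrite /translate /= xx.
Qed.

Lemma binary_coding_nonamenable : ~ amenable R (Aut mu).
Proof.
move=> /amenable_invariant_mean[m [mD mc mg]].
have mf (pi : nat -> nat) U : involutive pi -> m (f U) = m (f (U \o pi)).
  move=> piK; have [g H] := f_translate U piK.
  by rewrite -(mg g); congr m; apply/funext => a; exact: H.
have fD (U U' V : pred nat) : (forall i, (U i + U' i = V i :> nat)%N) ->
    m (f V) = m (f U) + m (f U').
  move=> UV; rewrite -mD; [|exact: f_bounded_uc|exact: f_bounded_uc].
  congr m; apply/funext => a; have mt := translate_measurable a.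
  have wU := is_weight_weight U; have wU' := is_weight_weight U'.
  rewrite /f -fineD ?(energy_fin mdelta bdelta mu_gt0 mt)//.
  rewrite -energyD//; congr (fine (energy _ _ _ _)).
  by apply/funext => F; rewrite (weightD _ _ UV).
pose E := [pred n : nat | ~~ odd n]; pose O := [pred n : nat | odd n].
pose P r := [pred n : nat | n %% 4 == r]%N.
have EO : m (f E) = m (f O).
  rewrite (mf swap_parity)//; last exact: swap_parityK.
  by congr (m (f _)); apply/funext => n; rewrite /= /swap_parity; case: ifP; lia.
have EP r : odd r -> (r < 4)%N -> m (f E) = m (f (P r)).
  move=> rodd r4; rewrite (mf (swap_mod4 r))//; last exact: swap_mod4K.
  by congr (m (f _)); apply/funext => n; rewrite /= even_swap_mod4.
have O13 : m (f O) = m (f (P 1%N)) + m (f (P 3%N)) by apply: fD => n /=; lia.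
have TEO : m (f predT) = m (f E) + m (f O) by apply: fD => n /=; lia.
have := EP 1%N isT isT; have := EP 3%N isT isT => E3 E1.
have E0 : m (f E) = 0 by lra.
have : m (f predT) = M * fine (mu A) - fine (mu A) ^+ 2.
  rewrite -[RHS]mc; congr m; apply/funext => a.
  by rewrite /f (energy_weightT mdelta bdelta ddelta mu_gt0) ?mu_translate//;
    exact: translate_measurable.
have mA : measurable A by exact: mdelta.
(* [A] is the parity set of the single digit 0, hence half of the space, and the constant is
   [M^2 / 4 > 0]. *)
have -> : fine (mu A) = M / 2.
  have := bdelta (F := [fset 0%N]%fset).
  rewrite (_ : parity_set _ _ = A).
    move=> /(_ _)/wrap[|<-].
      by apply/fset0Pn; exists 0%N; rewrite inE.
    by rewrite fineD ?fin_num_measure//; lra.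
  by apply/seteqP; split=> x; rewrite /parity_set /A /= /parity big_seq_fset1.
have := fine_mu_gt0 mu_gt0; rewrite TEO -EO E0 addr0 => M0.
nra.
Qed.

End nonamenable.

(** * Binary expansions *)

(** The head of the list is the most significant digit. *)
Definition binary_value (s : seq bool) : nat :=
  foldl (fun (a : nat) (b : bool) => a.*2 + b)%N 0%N s.

Section binary_expansion.
Context (R : realType).
Implicit Types (u v x : R) (b : nat -> bool) (n : nat).

(** The index of the dyadic interval of length [2^-n] containing [u]; on [0, 1[ it is the integer
    spelled by the first [n] digits. *)
Definition level n u : nat := Num.truncn (2 ^+ n * u).

(** Digits are numbered from 0, the [n]-th one having weight [2^-(n+1)]. Rounding down gives dyadic
    numbers their finite expansion. *)
Definition bit u n : bool := odd (level n.+1 u).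

Lemma level_itv n u : 0 <= u ->
  (level n u)%:R <= 2 ^+ n * u < (level n u).+1%:R.
Proof. by move=> u0; rewrite truncn_itv// mulr_ge0// exprn_ge0. Qed.

Lemma levelS n u : 0 <= u -> level n.+1 u = ((level n u).*2 + bit u n)%N.
Proof.
move=> u0; have /andP[h1 h2] := level_itv n u0; have /andP[h3 h4] := level_itv n.+1 u0.
rewrite exprS -mulrA in h3 h4.
have {}h1 : ((level n u).*2%:R : R) < (level n.+1 u).+1%:R.
  by apply: le_lt_trans h4; rewrite -muln2 natrM mulrC ler_pM2l.
have {}h2 : ((level n.+1 u)%:R : R) < (level n u).+1.*2%:R.
  by apply: le_lt_trans h3 _; rewrite -muln2 natrM [ltRHS]mulrC ltr_pM2l.
rewrite !ltr_nat in h1 h2.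
by rewrite /bit; lia.
Qed.

Lemma level0 u : 0 <= u < 1 -> level 0 u = 0%N.
Proof.
move=> /andP[u0 u1]; rewrite /level expr0 mul1r.
by apply: truncn_def; rewrite u0.
Qed.

Lemma level_mkseq n u : 0 <= u < 1 -> level n u = binary_value (mkseq (bit u) n).
Proof.
move=> u01; elim: n => [|n ih]; first by rewrite level0.
rewrite levelS; last by case/andP: u01.
by rewrite ih mkseqS /binary_value foldl_rcons.
Qed.

Lemma level_ltX n u : 0 <= u < 1 -> (level n u < 2 ^ n)%N.
Proof.
move=> /andP[u0 u1]; have /andP[h1 _] := level_itv n u0.
rewrite -(ltr_nat R) natrX; apply: le_lt_trans h1 _.
by rewrite gtr_pMr// exprn_gt0.
Qed.

Lemma exists_lt_exp2 x : exists n, x < 2 ^+ n.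
Proof.
exists (Num.truncn x).+1; apply: lt_trans (truncnS_gt x) _.
by rewrite -natrX ltr_nat ltn_expl.
Qed.

(** A mesh finer than [v - u] separates the two points. The order thereby becomes a countable union
    of conditions on finitely many digits. *)
Lemma level_ltP u v : 0 <= u -> 0 <= v -> u < v <-> exists n, (level n u < level n v)%N.
Proof.
move=> u0 v0; split=> [uv|[n]]; last first.
  apply: contraTT; rewrite -leNgt -leqNgt => vu; apply: le_truncn.
  by rewrite ler_wpM2l// exprn_ge0.
have [n hn] := exists_lt_exp2 (v - u)^-1; exists n.
have {}hn : 1 < 2 ^+ n * v - 2 ^+ n * u.
  by rewrite -mulrBr -ltr_pdivrMr ?subr_gt0// div1r.
have /andP[h1 h2] := level_itv n u0; have /andP[h3 h4] := level_itv n v0.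
have : ((level n u).+1%:R : R) < (level n v).+1%:R.
  by rewrite -natr1; lra.
by rewrite ltr_nat.
Qed.

Lemma bit_inj u v : 0 <= u < 1 -> 0 <= v < 1 -> bit u =1 bit v -> u = v.
Proof.
move=> u01 v01 uv; have lE n : level n u = level n v.
  by rewrite !level_mkseq//; congr binary_value; exact: eq_mkseq.
have [/andP[u0 _] /andP[v0 _]] := (u01, v01).
case: (ltgtP u v) => //.
  by move=> /(level_ltP u0 v0)[n]; rewrite lE ltnn.
by move=> /(level_ltP v0 u0)[n]; rewrite lE ltnn.
Qed.

(** If all digits from [n] on were 1, then [level (k + n) u + 1 = 2^k (level n u + 1)] for all [k],
    which forces [2^n u] up to [level n u + 1], against the strict bound of the integer part. *)
Lemma bit_zeros u n : 0 <= u < 1 -> exists2 m, (n <= m)%N & ~~ bit u m.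
Proof.
move=> u01; have /andP[u0 u1] := u01; apply: contrapT => H.
have ones m : (n <= m)%N -> bit u m.
  by move=> nm; apply: contrapT => /negP bm; apply: H; exists m.
have lE k : ((level (k + n) u).+1 = 2 ^ k * (level n u).+1)%N.
  elim: k => [|k ih]; first by rewrite mul1n.
  by rewrite addSn levelS// ones ?leq_addl// expnS -mulnA -ih; lia.
have /andP[_ h] := level_itv n u0.
have [k hk] := exists_lt_exp2 ((level n u).+1%:R - 2 ^+ n * u)^-1.
have {}hk : 1 < 2 ^+ k * (level n u).+1%:R - 2 ^+ k * (2 ^+ n * u).
  by rewrite -mulrBr -ltr_pdivrMr ?subr_gt0// div1r.
have /andP[h1 _] := level_itv (k + n) u0.
have : (level (k + n) u).+1%:R = 2 ^+ k * (level n u).+1%:R :> R.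
  by rewrite lE natrM natrX.
rewrite exprD -mulrA -natr1 in h1 *; lra.
Qed.

(** [u] is the supremum of the truncated expansions [q n]. The zeros of [b] make
    [u < (N n + 1) / 2^n] strict, so that [N n] is indeed the integer part of [2^n u]. *)
Lemma bit_surj b : (forall n, exists2 m, (n <= m)%N & ~~ b m) ->
  exists2 u, 0 <= u < 1 & bit u =1 b.
Proof.
move=> b0; pose N n := binary_value (mkseq b n).
have NS n : N n.+1 = ((N n).*2 + b n)%N by rewrite /N mkseqS /binary_value foldl_rcons.
have lo n k : (N n * 2 ^ k <= N (k + n))%N.
  elim: k => [|k ih]; first by rewrite muln1.
  by rewrite addSn NS expnS; lia.
have hi n k : (N (k + n) < (N n).+1 * 2 ^ k)%N.
  elim: k => [|k ih]; first by rewrite muln1.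
  by rewrite addSn NS expnS; case: (b _); lia.
pose q n : R := (N n)%:R / 2 ^+ n.
have p2 n : 0 < (2 : R) ^+ n by rewrite exprn_gt0.
have qhi n m : q m < (N n).+1%:R / 2 ^+ n.
  rewrite ltr_pdivrMr// mulrAC ltr_pdivlMr//.
  rewrite -!natrX -!natrM ltr_nat.
  have [nm|mn] := leqP n m.
    have := hi n (m - n)%N; rewrite subnK// => H.
    rewrite -{2}(subnK nm) expnD mulnA ltn_pmul2r ?expn_gt0//.
  have := lo m (n - m)%N; rewrite (subnK (ltnW mn)) => H.
  rewrite -{1}(subnK (ltnW mn)) expnD mulnA ltn_pmul2r ?expn_gt0//.
pose u := sup (range q).
have hs : has_sup (range q).
  split; first by exists (q 0%N), 0%N.
  by exists ((N 0%N).+1%:R / 2 ^+ 0) => _ [m _ <-]; exact/ltW/qhi.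
have uhi n : u <= (N n).+1%:R / 2 ^+ n.
  by apply: ge_sup; [exact: hs.1|move=> _ [m _ <-]; exact/ltW/qhi].
have ulo n : q n <= u by apply: ub_le_sup; [exact: hs.2|exists n].
(* At a zero [m >= n] one has [N (m + 1) + 1 = 2 N m + 1], strictly below [2 (N m + 1)]. *)
have uhi' n : u < (N n).+1%:R / 2 ^+ n.
  have [m nm bm] := b0 n.
  apply: le_lt_trans (uhi m.+1) _.
  rewrite ltr_pdivrMr// mulrAC ltr_pdivlMr//.
  rewrite -!natrX -!natrM ltr_nat NS (negPf bm) addn0.
  have := hi n (m - n)%N; rewrite subnK// => H.
  have -> : (2 ^ m.+1 = 2 ^ (m - n) * 2 ^ n * 2)%N by rewrite -expnD subnK// expnSr.
  rewrite !mulnA [ltnRHS]mulnAC ltn_pmul2r ?expn_gt0//; lia.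
have u01 : 0 <= u < 1.
  by rewrite (le_trans _ (ulo 0%N)) ?divr_ge0//=; have := uhi' 0%N; rewrite expr0 divr1.
exists u => // n; have u0 : 0 <= u by case/andP: u01.
have lE k : level k u = N k.
  apply: truncn_def; rewrite mulrC -ler_pdivrMr// -ltr_pdivlMr//.
  by rewrite uhi' ulo.
rewrite /bit lE NS; lia.
Qed.

End binary_expansion.

(** * Density of cylinders *)

Section cylinders.
Context (R : realType) (d : measure_display) (T : measurableType d).
Implicit Types (delta : T -> nat -> bool) (P : pred (seq bool)) (B C : set T).

Definition cylinder delta n P : set T := [set x | P (mkseq (delta x) n)].

Lemma cylinder_expansion n P : exists a : {set 'I_n} -> R,
  forall delta x, \1_(cylinder delta n P) x =
    \sum_(F : {set 'I_n}) a F * walsh R (delta x) (fset_of_ord F).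
Proof.
have [a aE] := walsh_expansion n (fun b => (P b)%:R : R).
exists a => delta x; rewrite -aE indicE; congr (_%:R); congr (nat_of_bool _).
by apply/idP/idP; rewrite inE.
Qed.

Lemma measurable_cylinder delta n P : measurable_digits delta ->
  measurable (cylinder delta n P).
Proof.
move=> md; have [a aE] := cylinder_expansion n P.
apply/(measurable_indicP R).
rewrite (_ : \1__ = fun x => \sum_(F : {set 'I_n}) a F * walsh R (delta x) (fset_of_ord F)).
  suff [] : bounded_measurable (fun x =>
    \sum_(F : {set 'I_n}) a F * walsh R (delta x) (fset_of_ord F)) by [].
  apply: bounded_measurable_sum => F.
  apply: bounded_measurableM; first exact: bounded_measurable_cst.
  exact: bounded_measurable_walsh.
exact/funext.
Qed.

(* The mass of a cylinder is its 0-th Walsh coefficient, which does not depend on the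
   coding. *)
Lemma balanced_cylinder (mu : {finite_measure set T -> \bar R}) delta delta' n P :
  measurable_digits delta -> measurable_digits delta' ->
  balanced_digits mu delta -> balanced_digits mu delta' ->
  mu (cylinder delta n P) = mu (cylinder delta' n P).
Proof.
move=> md md' bd bd'; have [a aE] := cylinder_expansion n P.
suff H e : measurable_digits e -> balanced_digits mu e ->
    fine (mu (cylinder e n P)) =
    \sum_(F : {set 'I_n}) a F * (if fset_of_ord F == fset0 then fine (mu setT) else 0).
  rewrite -[LHS]fineK ?fin_num_measure//; last exact: measurable_cylinder.
  rewrite -[RHS]fineK ?fin_num_measure//; last exact: measurable_cylinder.
  by congr EFin; rewrite !H.
move=> me be; rewrite -Rintegral_indic; last exact: measurable_cylinder.
under eq_Rintegral do rewrite aE.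
rewrite Rintegral_sum_bm; last first.
  move=> F; apply: bounded_measurableM; first exact: bounded_measurable_cst.
  exact: bounded_measurable_walsh.
apply: eq_bigr => F _; rewrite RintegralZ_bm; last exact: bounded_measurable_walsh.
by rewrite Rintegral_walsh.
Qed.

(** Restricting [mu] to the whole space gives the same measure with the finite-measure structure
    that [balanced_cylinder] takes. *)
Lemma balanced_cylinder_measure (mu : {measure set T -> \bar R}) delta delta' n P :
  (mu setT < +oo)%E ->
  measurable_digits delta -> measurable_digits delta' ->
  balanced_digits mu delta -> balanced_digits mu delta' ->
  mu (cylinder delta n P) = mu (cylinder delta' n P).
Proof.
move=> mu_fin md md' bd bd'.
pose fmu : {finite_measure set T -> \bar R} := mfrestr measurableT mu_fin.
have fmuE A : fmu A = mu A by rewrite -[in RHS](setIT A).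
have mfmuE A : (fmu : {measure set T -> \bar R}) A = mu A by exact: fmuE.
rewrite -!fmuE; apply: balanced_cylinder => // F F0.
  by rewrite !mfmuE bd.
by rewrite !mfmuE bd'.
Qed.

End cylinders.

(** * Approximation of measurable sets by cylinders *)

Section approximation.
Context (R : realType) (d : measure_display) (T : measurableType d).
Variables (mu : {measure set T -> \bar R}) (delta : T -> nat -> bool).
Hypothesis mu_fin : (mu setT < +oo)%E.
Hypothesis mdelta : measurable_digits delta.

Definition approximable (B : set T) : Prop := forall e, 0 < e ->
  exists n P, (mu (B `+` cylinder delta n P) < e%:E)%E.

Let mY (A B : set T) : measurable A -> measurable B -> measurable (A `+` B).
Proof. by move=> mA mB; apply: measurableU; exact: measurableD. Qed.

Let mcyl n P : measurable (cylinder delta n P).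
Proof. exact: (measurable_cylinder R). Qed.

Let lt_half (A B C : set T) (e : R) : measurable A -> measurable B -> measurable C ->
  C `<=` A `|` B -> (mu A < (e / 2)%:E)%E -> (mu B < (e / 2)%:E)%E -> (mu C < e%:E)%E.
Proof.
move=> mA mB mC CAB hA hB.
apply: (@le_lt_trans _ _ (mu A + mu B)%E).
  apply: le_trans (measureU2 _ mA mB); apply: le_measure; rewrite ?inE//.
  exact: measurableU.
by rewrite [e]splitr EFinD lteD.
Qed.

Lemma approximableU A B : measurable A -> measurable B ->
  approximable A -> approximable B -> approximable (A `|` B).
Proof.
move=> mA mB aA aB e e0; have e2 : 0 < e / 2 by rewrite divr_gt0.
have [n [P hA]] := aA _ e2; have [p [Q hB]] := aB _ e2.
exists (maxn n p), (fun s => P (take n s) || Q (take p s)).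
have E : cylinder delta (maxn n p) (fun s => P (take n s) || Q (take p s)) =
    cylinder delta n P `|` cylinder delta p Q.
  apply/seteqP; split=> x; rewrite /cylinder /=.
    by rewrite -!map_take !take_iota !(minn_idPl _) ?leq_maxl ?leq_maxr// => /orP.
  by rewrite -!map_take !take_iota !(minn_idPl _) ?leq_maxl ?leq_maxr// => /orP.
rewrite E; apply: (lt_half _ _ _ _ hA hB); [exact: mY|exact: mY| |].
  by apply: mY; exact: measurableU.
move=> x [[[Ax|Bx] /not_orP[nP nQ]]|[[Px|Qx] /not_orP[nA nB]]].
- by left; left.
- by right; left.
- by left; right.
- by right; right.
Qed.

Lemma approximable_bigsetU (A : (set T)^nat) n : (forall i, measurable (A i)) ->
  (forall i, approximable (A i)) -> approximable (\big[setU/set0]_(i < n) A i).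
Proof.
move=> mA aA; elim: n => [|n ih].
  rewrite big_ord0 => e e0; exists 0%N, pred0.
  rewrite (_ : _ `+` _ = set0) ?measure0//.
  by apply/seteqP; split=> x // -[[]|[]].
rewrite big_ord_recr /=; apply: approximableU => //.
by apply: bigsetU_measurable.
Qed.

(** The approximable measurable sets form a sigma-algebra: complements of cylinders are cylinders,
    and by continuity from below a countable union is within [e / 2] of a finite one. *)
Lemma dense_digits_generated (G : set (set T)) :
  measurable = <<s G>> -> G `<=` approximable -> dense_digits mu delta.
Proof.
move=> mG Ga.
suff : measurable `<=` [set A : set T | measurable A /\ approximable A].
  by move=> H B e mB e0; exact: (H B mB).2.
rewrite [X in X `<=` _]mG; apply: smallest_sub; last first.
  by move=> B GB; split; [rewrite mG; exact: sub_sigma_algebra|exact: Ga].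
split.
- split => // e e0; exists 0%N, pred0.
  rewrite (_ : _ `+` _ = set0) ?measure0//.
  by apply/seteqP; split=> x // -[[]|[]].
- move=> B [mB aB]; rewrite setTD; split; first exact: measurableC.
  move=> e /aB[n [P BP]]; exists n, (predC P).
  rewrite (_ : ~` B `+` _ = B `+` cylinder delta n P)//.
  apply/seteqP; split=> x; rewrite /setY /cylinder /=.
    by move=> [[nB /negP/negPn ?]|[/negP ? /contrapT ?]]; [right|left].
  move=> [[Bx /negP nP]|[Px nB]]; first by right; split => // /(_ Bx).
  by left; split => // /negP nP; apply: nP.
- move=> A /all_and2[mA aA]; split; first exact: bigcupT_measurable.
  move=> e e0; have e2 : 0 < e / 2 by rewrite divr_gt0.
  pose D n := \big[setU/set0]_(i < n) A i.
  have mD n : measurable (D n) by exact: bigsetU_measurable.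
  have mU : measurable (\bigcup_k A k) by exact: bigcupT_measurable.
  have UD : \bigcup_n D n = \bigcup_k A k.
    apply/seteqP; split=> x.
      by move=> [n _]; rewrite /D -bigcup_mkord => -[k _ Akx]; exists k.
    by move=> [k _ Akx]; exists k.+1 => //; rewrite /D -bigcup_mkord; exists k => /=.
  have Dh : {homo D : n m / (n <= m)%N >-> (n <= m)%O}.
    move=> n m nm; rewrite subsetEset /D -!bigcup_mkord => x [k /= kn Akx].
    by exists k => //=; exact: leq_trans nm.
  have := @nondecreasing_cvg_mu _ _ _ mu D mD; rewrite UD => /(_ mU Dh) cvgD.
  have finA (C : set T) : measurable C -> mu C \is a fin_num.
    move=> mC; rewrite ge0_fin_numE//; apply: le_lt_trans mu_fin.
    by apply: le_measure; rewrite ?inE.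
  have [N hN] : exists N, (mu (\bigcup_k A k `\` D N) < (e / 2)%:E)%E.
    apply: contrapT => /forallNP H.
    have : (mu (\bigcup_k A k) <= mu (\bigcup_k A k) - (e / 2)%:E)%E.
      apply: cvge_le cvgD; apply: nearW => N /=.
      have DU : \bigcup_k A k `&` D N = D N.
        by apply: setIidr => x Dx; rewrite -UD; exists N.
      have mUD : mu (\bigcup_k A k `\` D N) = (mu (\bigcup_k A k) - mu (D N))%E.
        by rewrite measureD ?DU// -ge0_fin_numE ?finA.
      have := H N; rewrite mUD.
      have := finA _ mU; have := finA _ (mD N).
      move: (mu (\bigcup_k A k)) (mu (D N)) => [x| |] [y| |]//= _ _.
      by rewrite -!EFinB lte_fin lee_fin => /negP; rewrite -leNgt; lra.
    have := finA _ mU; move: (mu (\bigcup_k A k)) => [x| |]//= _.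
    by rewrite -EFinB lee_fin; lra.
  have [n [P hP]] := approximable_bigsetU N mA aA e2.
  exists n, P; apply: (lt_half _ _ _ _ hN hP).
  + exact: measurableD.
  + exact: (mY (mD N) (mcyl _ _)).
  + exact: (mY mU (mcyl _ _)).
  move=> x [[Ux nP]|[Px nU]].
    by have [Dx|nD] := pselect (D N x); [right; left|left].
  by right; right; split => //; apply: contra_not nU => Dx; rewrite -UD; exists N.
Qed.

End approximation.

(** * The coding of an interval *)

(** Makes all digits of index below a given one functions of a single level. *)
Lemma level_div (R : realType) (u : R) n k : 0 <= u ->
  level n u = (level (k + n) u %/ 2 ^ k)%N.
Proof.
move=> u0; elim: k => [|k ih]; first by rewrite divn1.
rewrite addSn expnS divnMA (levelS _ u0) -muln2 divnDl ?dvdn_mull// mulnK//.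
by rewrite [(_ %/ 2)%N](_ : _ = 0%N) ?addn0//; case: (bit u _).
Qed.

Section interval_coding.
Context (R : realType).
Local Notation T := (measurableTypeR R).
Variables (nu : {measure set T -> \bar R}) (s : R).
Hypothesis s_gt0 : 0 < s.
Hypothesis nuE : forall B, measurable B -> nu B = lebesgue_measure (B `&` [set` `[0, s]]).

(** Meaningful on [0, s[ only, whose complement is null for [nu]. *)
Definition interval_digits (y : T) (n : nat) : bool := bit (y / s) n.

Local Notation delta := interval_digits.
Local Notation lev n y := (level n (y / s)).

Let unitP (y : R) : (0 <= y < s) = (0 <= y / s < 1).
Proof. by rewrite ler_pdivlMr// mul0r ltr_pdivrMr// mul1r. Qed.

Let measurable_lev n (P : set nat) : measurable [set y : T | P (lev n y)].
Proof.
have gtk k : measurable [set y : T | (k < lev n y)%N].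
  rewrite [X in measurable X](_ : _ = [set` `[k.+1%:R * s / 2 ^+ n, +oo[]).
    exact: measurable_itv.
  apply/seteqP; split=> y /=; rewrite in_itv /= andbT truncn_gt_nat mulrA
    -ler_pdivrMr ?invr_gt0// invrK ler_pdivrMr ?exprn_gt0//.
    by rewrite [y * _]mulrC.
  by rewrite [y * _]mulrC.
have eqk k : measurable [set y : T | lev n y = k].
  case: k => [|k].
    rewrite [X in measurable X](_ : _ = ~` [set y : T | (0 < lev n y)%N]).
      exact: measurableC.
    by apply/seteqP; split=> y /= => [->|/negP]; rewrite -?eqn0Ngt // => /eqP.
  rewrite [X in measurable X](_ : _ =
      [set y : T | (k < lev n y)%N] `\` [set y : T | (k.+1 < lev n y)%N]).
    exact: measurableD.
  apply/seteqP; split=> y /= => [->|[h1 /negP h2]]; first by rewrite ltnn ltnSn.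
  by lia.
rewrite [X in measurable X](_ : _ = \bigcup_(k in P) [set y : T | lev n y = k]).
  by apply: bigcup_measurable => k _; exact: eqk.
by apply/seteqP; split=> y /= => [Py|[k Pk ->]//]; exists (lev n y).
Qed.

Lemma measurable_interval_digits : measurable_digits delta.
Proof. by move=> n; exact: (measurable_lev n.+1 (fun k => odd k)). Qed.

Let nu_setT : nu setT = s%:E.
Proof.
by rewrite nuE// setTI lebesgue_measure_itv /= lte_fin s_gt0 oppr0 adde0.
Qed.

Let nu_compl : \forall y \ae nu, 0 <= y < s.
Proof.
exists (~` [set` `[0, s[]); split.
- by apply: measurableC; exact: measurable_itv.
- rewrite nuE; last by apply: measurableC; exact: measurable_itv.
  apply/eqP; rewrite -measure_le0 -(lebesgue_measure_set1 s).
  apply: le_measure; rewrite ?inE.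
  + by apply: measurableI; [apply: measurableC|]; exact: measurable_itv.
  + exact: measurable_set1.
  move=> y /= []; rewrite !in_itv /= => H /andP[y0 ys].
  by apply/eqP; move: H ys; rewrite y0 /= => /negP; rewrite -leNgt => sy ys;
    rewrite eq_le ys.
- by move=> y /=; rewrite in_itv.
Qed.

Let nu_eq B C : measurable B -> measurable C ->
  (forall y, 0 <= y < s -> B y <-> C y) -> nu B = nu C.
Proof.
move=> mB mC BC; apply: measure_ae_eq => //; have [N [mN N0 H]] := nu_compl.
by exists N; split=> // y /= nBC; apply: H => /= y01; apply: nBC; exact: BC.
Qed.

Let nu_lev n k : (k < 2 ^ n)%N -> nu [set y | lev n y = k] = (s / 2 ^+ n)%:E.
Proof.
move=> kn; rewrite nuE; last exact: (measurable_lev n (fun i => i = k)).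
have p2 : 0 < (2 : R) ^+ n by rewrite exprn_gt0.
rewrite (_ : _ `&` _ = [set` `[k%:R * s / 2 ^+ n, k.+1%:R * s / 2 ^+ n[]).
  rewrite lebesgue_measure_itv /= lte_fin ltr_pM2r ?invr_gt0// ltr_pM2r// ltr_nat ltnSn.
  by rewrite -EFinB -natr1; congr EFin; ring.
have key y : 0 <= y -> (lev n y == k) = (y \in `[k%:R * s / 2 ^+ n, k.+1%:R * s / 2 ^+ n[).
  move=> y0; rewrite truncn_eq; last by rewrite mulr_ge0 ?divr_ge0// ltW.
  rewrite in_itv /= ler_pdivrMr// ltr_pdivlMr// (_ : 2 ^+ n * (y / s) = y * 2 ^+ n / s).
    by rewrite ler_pdivlMr// ltr_pdivrMr.
  by rewrite mulrCA mulrA.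
apply/seteqP; split=> y /=.
  by move=> [/eqP yk]; rewrite in_itv /= => /andP[y0 _]; rewrite -key.
move=> yk; have y0 : 0 <= y.
  move: yk; rewrite in_itv /= => /andP[+ _]; apply: le_trans.
  by rewrite !divr_ge0 ?mulr_ge0// ltW.
split; first by apply/eqP; rewrite key.
move: yk; rewrite !in_itv /= y0 => /andP[_ /ltW yk]; apply: (le_trans yk).
by rewrite ler_pdivrMr// mulrC ler_pM2l// -natrX ler_nat.
Qed.

Let nu_partition n B : measurable B ->
  nu B = (\sum_(k < 2 ^ n) nu (B `&` [set y | lev n y = k]))%E.
Proof.
move=> mB; have mk k : measurable (B `&` [set y : T | lev n y = k]).
  by apply: measurableI => //; exact: (measurable_lev n (fun i => i = k)).
transitivity (nu (\big[setU/set0]_(k < 2 ^ n) (B `&` [set y : T | lev n y = k])));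
  last first.
  apply: (@measure_bigsetU _ _ _ nu (fun k => B `&` [set y : T | lev n y = k])) => //.
  by move=> i j _ _ [y [[_ <-] [_ <-]]].
apply: nu_eq => //; first by apply: bigsetU_measurable => k _; exact: mk.
move=> y y01; rewrite -(bigcup_mkord (2 ^ n) (fun k => B `&` [set y : T | lev n y = k])).
split=> [By|[k _ []//]].
exists (lev n y) => //=; apply: level_ltX; by rewrite -unitP.
Qed.

(* Within an interval of given first n digits, where n is the largest element of F,
   exactly one of the two values of the n-th digit gives odd parity. *)
Lemma balanced_interval_digits : balanced_digits nu delta.
Proof.
move=> F F0; have [n nF Fn] : exists2 n, n \in F & forall i, i \in F -> (i <= n)%N.
  have ex : exists i, i \in F by exact/fset0Pn.
  have bd i : i \in F -> (i <= \max_(j <- F) j)%N by move=> iF; exact: leq_bigmax_seq.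
  by case: (ex_maxnP ex bd) => n nF nmax; exists n.
(* [Q k] is the parity of the digits in [F] other than the [n]-th one, read off from the level [k]
   of order [n]. *)
pose Q k := \big[addb/false]_(i <- (F `\ n)%fset) odd (k %/ 2 ^ (n - i.+1)).
have parE y : 0 <= y < s -> parity (delta y) F = delta y n (+) Q (lev n y).
  move=> y01; rewrite /parity (big_fsetD1 n)//=; congr (_ (+) _).
  rewrite /Q !big_seq; apply: eq_bigr => i; rewrite !inE => /andP[ni /Fn iN].
  have y0 : 0 <= y / s by move: y01; rewrite unitP => /andP[].
  by rewrite /interval_digits /bit (level_div i.+1 (n - i.+1) y0) subnK// ltn_neqAle ni.
have mpar := measurable_parity_set F measurable_interval_digits.
have half k : (k < 2 ^ n)%N ->
    nu (parity_set delta F `&` [set y | lev n y = k]) = (s / 2 ^+ n.+1)%:E.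
  (* Odd parity forces the [n]-th digit to be the negation of [Q k], so the intersection is one of
     the two halves of the dyadic interval. *)
  move=> kn; rewrite -(@nu_lev n.+1 (k.*2 + ~~ Q k)%N); last first.
    by rewrite expnS; case: (Q k); lia.
  apply: nu_eq; [apply: measurableI => //|..].
  - exact: (measurable_lev n (fun i => i = k)).
  - exact: (measurable_lev n.+1 (fun i => i = (k.*2 + ~~ Q k)%N)).
  move=> y y01; have y0 : 0 <= y / s by move: y01; rewrite unitP => /andP[].
  rewrite /parity_set /= parE// levelS// -[bit _ _]/(delta y n); split.
    by move=> [+ yk]; rewrite yk; case: (delta y n); case: (Q k).
  move=> H; have yk : lev n y = k.
    by move: (lev n y) (Q k) (delta y n) H => a [] [] /=; lia.
  split => //; move: H; rewrite yk.
  by move: (Q k) (delta y n) => [] [] //=; lia.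
rewrite nu_setT (nu_partition n)// (eq_bigr (fun=> (s / 2 ^+ n.+1)%:E)); last first.
  by move=> k _; rewrite half.
transitivity ((s / 2 ^+ n.+1 *+ 2 ^ n + s / 2 ^+ n.+1 *+ 2 ^ n)%:E).
  by rewrite sumEFin -EFinD sumr_const card_ord.
have p2 : (2 : R) ^+ n != 0 by rewrite expf_neq0.
by rewrite -(mulr_natr _ (2 ^ n)) natrX exprS; congr EFin; field.
Qed.

Let nu_lev_le n k : (nu [set y | lev n y = k] <= (s / 2 ^+ n)%:E)%E.
Proof.
have [kn|kn] := ltnP k (2 ^ n); first by rewrite nu_lev.
rewrite (@nu_eq _ set0) ?measure0 ?lee_fin ?divr_ge0 ?exprn_ge0 ?ltW//.
  exact: (measurable_lev n (fun i => i = k)).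
move=> y; rewrite unitP => /(level_ltX n); split=> //= yk.
by move: kn; rewrite leqNgt -yk => /negP.
Qed.

Let cylinder_lev n (P : pred nat) y : 0 <= y < s ->
  cylinder delta n (fun b => P (binary_value b)) y = P (lev n y) :> Prop.
Proof. by rewrite unitP => y01; rewrite /cylinder /= level_mkseq. Qed.

(** Open left rays generate the Borel sets. Within [0, s[, such a ray and the cylinder of the points
    of smaller level than [x] differ only inside the level set of [x], of mass at most [s / 2^n]. *)
Lemma dense_interval_digits : dense_digits nu delta.
Proof.
apply: (@dense_digits_generated _ _ _ nu delta _ _ (@RGenInftyO.G R)).
- by rewrite nu_setT ltry.
- exact: measurable_interval_digits.
- exact: (RGenInftyO.measurableE R).
move=> _ [x ->] e e0.
have [n hn] := exists_lt_exp2 (s / e).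
have p2 : 0 < (2 : R) ^+ n by rewrite exprn_gt0.
exists n, (fun b => binary_value b < lev n x)%N.
have mcyl := measurable_cylinder R n
  (fun b => binary_value b < lev n x)%N measurable_interval_digits.
apply: (@le_lt_trans _ _ (s / 2 ^+ n)%:E); last first.
  by rewrite lte_fin ltr_pdivrMr// mulrC -ltr_pdivrMr.
apply: le_trans (nu_lev_le n (lev n x)).
pose S := [set y : T | lev n y = lev n x]; rewrite -/S;
  have mS : measurable S by exact: (measurable_lev n (fun i => i = lev n x)).
set Y := _ `+` _; have mY : measurable Y.
  by apply: measurableU; apply: measurableD => //; exact: measurable_itv.
have mSY : measurable (S `&` Y) by exact: measurableI.
suff -> : nu Y = nu (S `&` Y) by apply: le_measure; rewrite ?inE.
apply: nu_eq => //.
move=> y y01; split=> [|[]//] H; split => //.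
have y0 : 0 <= y / s by move: y01; rewrite unitP => /andP[].
have cE : cylinder delta n (fun b => binary_value b < lev n x)%N y = (lev n y < lev n x)%N :> Prop.
  exact: (@cylinder_lev n (fun k => k < lev n x)%N).
move: H; rewrite /Y /setY /= cE in_itv /= => -[[yx /negP]|[yx /negP]].
  rewrite -leqNgt /S /= => H; apply/eqP; rewrite eqn_leq H andbT.
  by apply: le_truncn; rewrite ler_wpM2l ?exprn_ge0// ler_wpM2r ?invr_ge0 ?ltW.
rewrite -leNgt => xy; exfalso; move: yx; rewrite ltnNge => /negP; apply.
by apply: le_truncn; rewrite ler_wpM2l ?exprn_ge0// ler_wpM2r// invr_ge0 ltW.
Qed.

Let digits_inj y z : 0 <= y < s -> 0 <= z < s -> delta y =1 delta z -> y = z.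
Proof.
rewrite !unitP => y01 z01 /(bit_inj y01 z01) yz.
by rewrite -[y](mulfVK (lt0r_neq0 s_gt0)) yz mulfVK// lt0r_neq0.
Qed.

(* A sequence is the expansion of a point of [0, s[ iff it has infinitely many zeros,
   a condition that is stable under permutation of the digits. *)
Let digits_permute (pi : nat -> nat) y : involutive pi -> 0 <= y < s ->
  exists2 z, 0 <= z < s & forall n, delta z n = delta y (pi n).
Proof.
move=> piK y01; have [|u u01 ub] := @bit_surj R (fun n => delta y (pi n)).
  move=> n; move: y01; rewrite unitP => y01.
  (* A zero at an index beyond [pi 0, ..., pi (n - 1)] is moved by the involution to an index at
     least [n]. *)
  have [z nz dz] := bit_zeros (\max_(i < n) pi i).+1 y01.
  exists (pi z); last by rewrite piK.
  rewrite leqNgt; apply/negP => zn; move: nz; rewrite ltnNge => /negP; apply.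
  by rewrite -{1}(piK z); exact: (leq_bigmax (Ordinal zn)).
have uE : u * s / s = u by rewrite mulfK// lt0r_neq0.
by exists (u * s); rewrite ?unitP ?uE// => n; rewrite /interval_digits uE ub.
Qed.

(** [g] permutes the digits on [0, s[ and fixes the other points. Being obtained by choice, it is
    controlled through rays: on [0, s[ a ray is an increasing union of cylinders, and its preimage
    is the union of the same cylinders for the permuted digits. These are balanced too, so the
    masses agree. *)
Lemma exchangeable_interval_digits : exchangeable_digits nu delta.
Proof.
move=> pi piK; have pi_inj := inv_inj piK.
have /choice[g gP] : forall y : T, exists z : T,
    (0 <= y < s -> 0 <= z < s /\ forall n, delta z n = delta y (pi n)) /\
    (~ 0 <= y < s -> z = y).
  move=> y; have [y01|y01] := pselect (0 <= y < s); last by exists y.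
  by have [z zs zd] := digits_permute piK y01; exists z.
have gin y : 0 <= y < s -> 0 <= g y < s by move=> /(gP y).1[].
have gd y n : 0 <= y < s -> delta (g y) n = delta y (pi n) by move=> /(gP y).1[].
have gout y : ~ 0 <= y < s -> g y = y by exact: (gP y).2.
have gK : involutive g.
  move=> y; have [y01|y01] := pselect (0 <= y < s); last by rewrite !gout.
  by apply: digits_inj => [||n]; rewrite ?gin// !gd ?gin// piK.
pose delta' (y : T) n := delta y (pi n).
have par' F : parity_set delta' F = parity_set delta (pi @` F)%fset.
  apply/seteqP; split=> y; rewrite /parity_set /= /parity big_imfset //=;
    by move=> ? ? _ _; exact: pi_inj.
have mdelta' : measurable_digits delta' by move=> n; exact: measurable_interval_digits.
have bdelta' : balanced_digits nu delta'.
  move=> F F0; rewrite par'; apply: balanced_interval_digits.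
  by have /fset0Pn[i iF] := F0; apply/fset0Pn; exists (pi i); exact: in_imfset.
pose ray (x : R) : set T := [set` `]-oo, x[].
pose I : set T := [set` `[0, s[].
have mI : measurable I by exact: measurable_itv.
have mray x : measurable (ray x) by exact: measurable_itv.
have IE y : I y = (0 <= y < s) by rewrite /I /= in_itv.
(* [level_ltP] compares nonnegative numbers; passing to the positive part does not change the trace
   of the ray on [0, s[. *)
pose xp (x : R) : R := Num.max x 0.
have xp0 x : 0 <= xp x / s by rewrite divr_ge0 ?(ltW s_gt0)// /xp le_max lexx orbT.
pose below x (e : T -> nat -> bool) n : set T :=
  cylinder e n (fun b => binary_value b < lev n (xp x))%N.
have mbelow x e n : measurable_digits e -> measurable (below x e n).
  by move=> me; exact: (measurable_cylinder R).
have below_homo x e : {homo below x e : n m / (n <= m)%N >-> (n <= m)%O}.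
  apply: homo_leq => [n|n m p|n]; first exact: lexx.
    exact: le_trans.
  rewrite subsetEset => y; rewrite /below /cylinder /= mkseqS /binary_value foldl_rcons.
  rewrite levelS//.
  by move: (bit _ n) (e y n) => [] []; lia.
have rayI x y : 0 <= y < s -> y < x <-> exists n, (lev n y < lev n (xp x))%N.
  move=> y01; have y0 : 0 <= y / s by move: y01; rewrite unitP => /andP[].
  rewrite -level_ltP// /xp ltr_pM2r ?invr_gt0// lt_max; have /andP[yy _] := y01.
  by rewrite [y < 0]ltNge yy orbF.
have below_ray x y : 0 <= y < s -> (\bigcup_n below x delta n) y <-> ray x y.
  move=> y01; rewrite /ray /= in_itv /= (rayI _ _ y01).
  split=> [[n _]|[n H]]; last exists n => //; rewrite ?/below ?/cylinder /=.
    by move=> H; exists n; rewrite level_mkseq -?unitP.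
  by rewrite -level_mkseq -?unitP.
have below_gray x y : 0 <= y < s -> (\bigcup_n below x delta' n) y <-> ray x (g y).
  move=> y01; rewrite -(below_ray x (g y)) ?gin//.
  have E n : mkseq (delta (g y)) n = mkseq (delta' y) n by apply: eq_mkseq => i;
    rewrite gd.
  by split=> -[n _]; rewrite /below /cylinder /= => H; exists n => //=; move: H;
    rewrite E.
have mU x e : measurable_digits e -> measurable (\bigcup_n below x e n).
  by move=> me; apply: bigcupT_measurable => n; exact: mbelow.
have gray x : g @^-1` ray x = (I `&` \bigcup_n below x delta' n) `|` (ray x `\` I).
  apply/seteqP; split=> y.
    move=> gyx; have [y01|y01] := pselect (0 <= y < s).
      by left; split; [rewrite IE|apply/below_gray].
    by right; split; [move: gyx; rewrite /preimage /= gout|rewrite IE].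
  move=> [[]|[]]; rewrite IE; first by move=> y01 /(below_gray _ _ y01).
  by move=> yx y01; rewrite /preimage /= gout.
have mg : measurable_fun setT g.
  apply: (measurability (@RGenInftyO.G R)); first exact: (RGenInftyO.measurableE R).
  move=> _ [_ [x ->] <-]; rewrite setTI -/(ray x) gray.
  by apply: measurableU; [apply: measurableI => //; exact: mU|exact: measurableD].
exists g; split => //; last first.
  by case: nu_compl => N [mN N0 H]; exists N; split => // y /= nE; apply: H => /= y01;
    apply: nE => n; exact: gd.
have nu_ray x : nu (g @^-1` ray x) = nu (ray x).
  transitivity (nu (\bigcup_n below x delta' n)).
    apply: nu_eq; [by rewrite -[X in measurable X]setTI; exact: mg|exact: mU|].
    by move=> y y01; rewrite below_gray.
  transitivity (nu (\bigcup_n below x delta n)); last first.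
    by apply: nu_eq; [apply: mU;
      exact: measurable_interval_digits|exact: mray|exact: below_ray].
  have md := measurable_interval_digits.
  have h1 := @nondecreasing_cvg_mu _ _ _ nu _
    (mbelow x _ ^~ mdelta') (mU x _ mdelta') (below_homo x _).
  have h2 := @nondecreasing_cvg_mu _ _ _ nu _
    (mbelow x _ ^~ md) (mU x _ md) (below_homo x _).
  have E : nu \o below x delta' = nu \o below x delta.
    apply/funext => n /=; apply: balanced_cylinder_measure => //.
    - by rewrite nu_setT ltry.
    - exact: balanced_interval_digits.
  have {}h1 : (nu \o below x delta) k @[k --> \oo] --> nu (\bigcup_n below x delta' n).
    by rewrite -E; exact: h1.
  exact: (cvg_unique (@ereal_hausdorff R) h1 h2).
move=> A mA.
pose pnu : {measure set T -> \bar R} :=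
  measure_function_pushforward__canonical__measure_function_Measure nu mg.
apply: (@measure_unique _ R T (@RGenInftyO.G R) (fun n => ray n%:R) _ _ _ _ pnu nu) => //.
- exact: (RGenInftyO.measurableE R).
- move=> _ _ [x ->] [y ->]; exists (Num.min x y); apply/seteqP; split=> z /=;
  rewrite !in_itv /= lt_min.
    by move=> [-> ->].
  by move=> /andP[].
- by move=> n; exists n%:R.
- by apply/seteqP; split=> // y _; exists (Num.truncn y).+1 => //;
  rewrite /ray /= in_itv /= truncnS_gt.
- by move=> _ [x ->]; exact: nu_ray.
- move=> n; rewrite /pnu /= /pushforward nu_ray; apply: le_lt_trans (ltry s).
  by rewrite -nu_setT; apply: le_measure; rewrite ?inE.
Qed.

Lemma interval_binary_coding : binary_coding nu delta.
Proof.
split; [exact: measurable_interval_digits|exact: balanced_interval_digits|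
  exact: dense_interval_digits|exact: exchangeable_interval_digits].
Qed.

End interval_coding.

(** * Transport of codings *)

Section completion.
Context (R : realType) (d : measure_display) (T : measurableType d).
Variables (mu : {measure set T -> \bar R}) (delta : T -> nat -> bool).
Hypothesis mu_fin : (mu setT < +oo)%E.
Hypothesis coding : binary_coding mu delta.

Local Notation cmu := (@completed_measure_extension _ _ _ mu
  : {measure set (caratheodory_type (mu^*)%mu) -> \bar R}).

Let cmuE (A : set T) : measurable A -> cmu A = mu A.
Proof. exact: measurable_mu_extE. Qed.

Let mcompleted (A : set T) : measurable A ->
  measurable (A : set (caratheodory_type (mu^*)%mu)).
Proof. exact: caratheodory_measurable_mu_ext. Qed.

Let mu_ext_preimage_le (phi : T -> T) A : measurable_fun setT phi ->
  (forall B, measurable B -> mu (phi @^-1` B) = mu B) ->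
  ((mu^*)%mu (phi @^-1` A) <= (mu^*)%mu A)%E.
Proof.
move=> mphi pphi.
apply: le_ereal_inf_tmp => _ [F [mF AF] <-]; apply: ereal_inf_lbound => /=.
exists (fun k => phi @^-1` F k).
  split=> [i|x /AF[k _ Fk]]; last by exists k.
  by rewrite -[X in measurable X]setTI; exact: mphi.
by apply: eq_eseriesr => k _; rewrite pphi.
Qed.

(** For density, a set of the completion is first enclosed in a set of the original sigma-algebra of
    almost the same measure. For exchangeability, [phi] preserves the outer measure, hence
    Caratheodory measurability. *)
Lemma completion_binary_coding : binary_coding cmu delta.
Proof.
have [md bd dd ed] := coding.
split.
- by move=> n; apply: mcompleted; exact: md.
- move=> F F0; have mF := measurable_parity_set F md.
  by rewrite !cmuE// bd.
- move=> B e mB e0; have e2 : 0 < e / 2 by rewrite divr_gt0.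
  have cfin : (cmu B < +oo)%E.
    apply: le_lt_trans mu_fin; rewrite -cmuE//; apply: le_measure; rewrite ?inE//.
  have cfn : cmu B \is a fin_num by rewrite ge0_fin_numE.
  have [U [mU BU hU]] : exists U : set T,
      [/\ measurable U, B `<=` U & (mu U < cmu B + (e / 2)%:E)%E].
    have /(lb_ereal_inf_adherent e2)[_ [F [mF BF] <-] hF] := cfn.
    exists (\bigcup_k F k); split=> //; first exact: bigcupT_measurable.
    apply: le_lt_trans hF.
    by apply: measure_sigma_subadditive => //; exact: bigcupT_measurable.
  have [n [P hP]] := dd U _ mU e2; exists n, P.
  have mC := measurable_cylinder R n P md.
  have mUC : measurable (U `+` cylinder delta n P).
    by apply: measurableU; exact: measurableD.
  have mcU := mcompleted mU; have mcC := mcompleted mC; have mcUC := mcompleted mUC.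
  have hUB : (cmu (U `\` B) < (e / 2)%:E)%E.
    have UB : U `&` B = B by exact: setIidr.
    have hU' : (cmu U < cmu B + (e / 2)%:E)%E by rewrite cmuE.
    have Ufin : (cmu U < +oo)%E.
      by apply: (lt_trans hU'); apply: lte_add_pinfty => //; exact: ltry.
    have -> : cmu (U `\` B) = (cmu U - cmu B)%E by rewrite measureD ?UB.
    by rewrite lteBlDl.
  rewrite -cmuE// in hP.
  apply: (@le_lt_trans _ _ (cmu (U `\` B) + cmu (U `+` cylinder delta n P))%E).
    apply: le_trans (measureU2 _ _ _) => //; last exact: measurableD.
    apply: le_measure; rewrite ?inE.
    + by apply: measurableU; apply: measurableD.
    + by apply: measurableU => //; exact: measurableD.
    move=> x [[Bx nP]|[Px nB]]; first by right; left; split => //; exact: BU.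
    have [Ux|nU] := pselect (U x); first by left.
    by right; right.
  by rewrite [e]splitr EFinD lteD.
- move=> pi piK; have [phi [phiK mphi pphi dphi]] := ed pi piK.
  (* The inequality for [A] and the one for its preimage, as [phi] is an involution. *)
  have ext_pre A : (mu^*)%mu (phi @^-1` A) = (mu^*)%mu A.
    apply/eqP; rewrite eq_le mu_ext_preimage_le//=.
    have := mu_ext_preimage_le (phi @^-1` A) mphi pphi.
    by congr (_ <= _)%E; congr ((mu^*)%mu _); apply/seteqP; split=> x /=;
      rewrite /preimage /= phiK.
  exists phi; split=> //.
  + move=> _ A mA; rewrite setTI.
    change (caratheodory_measurable (mu^*)%mu (phi @^-1` A)) => X.
    have XE : X = phi @^-1` (phi @^-1` X) by apply/seteqP; split=> x /=;
      rewrite /preimage /= phiK.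
    have mA' : caratheodory_measurable (mu^*)%mu A := mA.
    rewrite -[LHS]ext_pre mA' -(ext_pre (_ `&` A)) -(ext_pre (_ `&` ~` A)).
    by rewrite !preimage_setI -XE preimage_setC.
  + by move=> A _; exact: ext_pre.
  + case: dphi => N [mN N0 H]; exists N; split => //; first exact: mcompleted.
    by rewrite -N0; exact: cmuE.
Qed.

End completion.

Section transport.
Context (R : realType) (d1 d2 : measure_display).
Context (T1 : measurableType d1) (T2 : measurableType d2).
Variables (mu : {measure set T1 -> \bar R}) (nu : {measure set T2 -> \bar R}).

Lemma isomorphic_mod0_setT : isomorphic_mod0 mu nu -> mu setT = nu setT.
Proof.
move=> [X [Y [f [[mX mY X0 Y0] _ _ _ pf]]]].
rewrite -pf// preimage_setT setIT.
by apply: measure_ae_eq => //; exists (~` X); split=> //;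
  [exact: measurableC|move=> x /= H Xx; apply: H].
Qed.

(** By injectivity the preimage of [y] in [X] has at most one point, so each of its subsets is empty
    or everything. *)
Lemma isomorphic_mod0_atom y : isomorphic_mod0 mu nu -> measurable [set y] ->
  (0 < nu [set y])%E -> exists A, atom mu A.
Proof.
move=> [X [Y [f [[mX mY X0 Y0] [_ finj _] mf _ pf]]]] my y0.
exists (X `&` f @^-1` [set y]); split; [exact: mf|by rewrite pf|].
move=> B mB BA; have [->|/set0P[b Bb]] := eqVneq B set0; first by left;
  rewrite measure0.
right; congr (mu _); apply/seteqP; split=> // x [Xx fx].
have [Xb fb] := BA _ Bb.
by rewrite (finj x b) ?inE// fx fb.
Qed.

(** Digits are pulled back along [f] and set to 0 off [X]; involutions are conjugated by [f] where
    this makes sense and are the identity elsewhere. *)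
Lemma isomorphic_mod0_coding delta : isomorphic_mod0 mu nu ->
  binary_coding nu delta -> exists delta', binary_coding mu delta'.
Proof.
move=> iso; have mT := isomorphic_mod0_setT iso.
move: iso => [X [Y [f [[mX mY X0 Y0] [fXY finj fsurj] mf fm pf]]]] [md bd dd ed].
pose delta' x n := `[< X x >] && delta (f x) n.
have aeX : \forall x \ae mu, X x.
  by exists (~` X); split=> //; exact: measurableC.
have mpre B : measurable B -> measurable (X `&` f @^-1` B) by move=> mB; exact: mf.
exists delta'.
have md' : measurable_digits delta'.
  move=> n; rewrite (_ : [set x | _] = X `&` f @^-1` [set y | delta y n]);
    first exact: mpre.
  apply/seteqP; split=> x; rewrite /delta' /=; first by move=> /andP[/asboolP].
  by move=> [/asboolP -> ->].
have dE x : X x -> delta' x = delta (f x).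
  by move=> Xx; apply/funext => n; rewrite /delta' asboolT.
split=> //.
- move=> F F0; have mF := measurable_parity_set F md;
  have mF' := measurable_parity_set F md'.
  rewrite mT -(bd F F0) -pf//; congr (_ + _)%E; apply: measure_ae_eq => //;
    try exact: mpre;
  by apply: filterS aeX => x Xx; rewrite /parity_set /= dE//; split=> [|[]].
- move=> B e mB e0; have mfB : measurable (f @` (B `&` X)).
    by apply: fm; [exact: measurableI|move=> x []].
  have [n [P hP]] := dd _ _ mfB e0; exists n, P.
  have mC := measurable_cylinder R n P md; have mC' := measurable_cylinder R n P md'.
  have mY1 : measurable (f @` (B `&` X) `+` cylinder delta n P) by apply: measurableU;
    exact: measurableD.
  rewrite -pf// in hP; apply: le_lt_trans hP.
  rewrite le_eqVlt; apply/orP; left; apply/eqP; apply: measure_ae_eq.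
  + by apply: measurableU; exact: measurableD.
  + exact: mpre.
  apply: filterS aeX => x Xx; rewrite /setY /cylinder /= dE//.
  have BE : (exists2 x0, (B `&` X) x0 & f x0 = f x) <-> B x.
    split=> [[z [Bz Xz]] /finj <-//|Bx]; rewrite ?inE//.
    by exists x.
  by rewrite BE; split=> [|[]].
- move=> pi piK; have [g [gK mg pg dg]] := ed pi piK.
  (* Since g is an involution, f @` X' = Y `&` g @^-1` Y is stable under g. *)
  pose X' := X `&` f @^-1` (g @^-1` Y).
  have mg' B : measurable B -> measurable (g @^-1` B).
    by move=> mB; rewrite -[X in measurable X]setTI; exact: mg.
  have mX' : measurable X' by apply: mpre; exact: mg'.
  (* A point outside [X'] lies off [X] or is sent by [f] into the preimage under [g] of the
     complement of [Y], null because [g] preserves [nu]. *)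
  have aeX' : \forall x \ae mu, X' x.
    exists (~` X'); split=> //; first exact: measurableC.
    apply/eqP; rewrite -measure_le0.
    have nX : (mu (X `&` f @^-1` (g @^-1` (~` Y))) = 0)%E.
      by rewrite pf ?pg//; [exact: measurableC|apply: mg'; exact: measurableC].
    rewrite -[leRHS]adde0 -{1}X0 -nX.
    apply: le_trans (measureU2 _ _ _); last 2 first.
    + exact: measurableC.
    + by apply: mpre; apply: mg'; exact: measurableC.
    apply: le_measure; rewrite ?inE.
    + exact: measurableC.
    + apply: measurableU; first exact: measurableC.
      by apply: mpre; apply: mg'; exact: measurableC.
    move=> x nX'; have [Xx|nXx] := pselect (X x); last by left.
    by right; split=> // Yx; apply: nX'.
  have /choice[phi phiP] : forall x, exists x',
      (X' x -> X x' /\ f x' = g (f x)) /\ (~ X' x -> x' = x).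
    move=> x; have [X'x|nX'x] := pselect (X' x); last by exists x.
    by have [x' Xx' fx'] := fsurj _ X'x.2; exists x'.
  have phiX x : X' x -> X (phi x) by move=> /(phiP x).1[].
  have fphi x : X' x -> f (phi x) = g (f x) by move=> /(phiP x).1[].
  have phiN x : ~ X' x -> phi x = x by exact: (phiP x).2.
  have phiX' x : X' x -> X' (phi x).
    move=> X'x; split; first exact: phiX.
    by rewrite /preimage /= fphi// gK; apply: fXY; exact: X'x.1.
  have phiK : involutive phi.
    move=> x; have [X'x|nX'x] := pselect (X' x); last by rewrite !phiN.
    apply: finj; rewrite ?inE; [exact: phiX (phiX' _ X'x)|exact: X'x.1|].
    by rewrite fphi ?fphi ?gK//; exact: phiX'.
  (* [phi] comes from choice; its preimages become measurable by being written with [X'] and with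
     images and preimages under [f] and [g]. *)
  have phiE A : measurable A -> phi @^-1` A =
      (X' `&` (X `&` f @^-1` (g @^-1` (f @` (A `&` X))))) `|` (A `\` X').
    move=> mA; apply/seteqP; split=> x.
      move=> Ax; have [X'x|nX'x] := pselect (X' x).
        left; split=> //; split; first exact: X'x.1.
        by exists (phi x); [split => //; exact: phiX|exact: fphi].
      by right; split=> //; rewrite -(phiN x).
    move=> [[X'x [Xx [a [Aa Xa] fa]]]|[Ax nX'x]]; last by rewrite /preimage /= phiN.
    rewrite /preimage /= (_ : phi x = a)//; apply: finj; rewrite ?inE//;
      first exact: phiX.
    by rewrite fphi.
  have mimg A : measurable A -> measurable (f @` (A `&` X)).
    by move=> mA; apply: fm; [exact: measurableI|move=> x []].
  have mphi : measurable_fun setT phi.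
    move=> _ A mA; rewrite setTI phiE//; apply: measurableU; last exact: measurableD.
    by apply: measurableI => //; apply: mpre; apply: mg'; exact: mimg.
  exists phi; split=> //.
  + move=> A mA; have mfA := mimg A mA.
    transitivity (mu (X `&` f @^-1` (g @^-1` (f @` (A `&` X))))).
      apply: measure_ae_eq.
      - by rewrite -[X in measurable X]setTI; exact: mphi.
      - by apply: mpre; exact: mg'.
      apply: filterS aeX' => x X'x; rewrite phiE//; split=> [[[]//|[]//]|H].
      by left.
    rewrite pf ?pg//; last exact: mg'.
    rewrite -pf//; apply: measure_ae_eq => //; first exact: mpre.
    apply: filterS aeX => x Xx; split=> [[_ [a [Aa Xa]]] /finj <-//|Ax]; rewrite ?inE//.
    by split=> //; exists x.
  + have [N [mN N0 H]] := dg.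
    have aeN : \forall x \ae mu, ~ (X `&` f @^-1` N) x.
      exists (X `&` f @^-1` N); split; [exact: mpre|by rewrite pf|].
      by move=> x /contrapT.
    apply: filterS2 aeX' aeN => x X'x nN n.
    rewrite !dE; [|exact: X'x.1|exact: phiX].
    rewrite fphi//; move: n; apply: contrapT => nH; apply: nN; split;
      first exact: X'x.1.
    exact: H.
Qed.

End transport.

(** * The model space and the exclusion of atoms *)

Section model.
Context (R : realType) (s : {nonneg R}) (p : nat -> {nonneg R}).

Lemma lebesgue_modelE (B : set (measurableTypeR R)) : lebesgue_model s p B =
  (lebesgue_measure (B `&` [set` `[0%R, s%:num]]) +
   \sum_(0 <= n <oo) ((p n)%:num%:E * \d_((- n.+1%:R)%R : measurableTypeR R) B))%E.
Proof. exact: measure_addE. Qed.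

Lemma lebesgue_model_point n : 0 < (p n)%:num ->
  (0 < lebesgue_model s p [set (- n.+1%:R)%R : measurableTypeR R])%E.
Proof.
move=> pn; rewrite lebesgue_modelE.
set f := fun k : nat => ((p k)%:num%:E *
  \d_((- k.+1%:R)%R : measurableTypeR R) [set (- n.+1%:R)%R : measurableTypeR R])%E.
have f0 k : (0 <= f k)%E by rewrite mule_ge0 ?lee_fin.
have fn : f n = (p n)%:num%:E by rewrite /f diracE mem_set ?mule1.
apply: (@lt_le_trans _ _ (f n)); first by rewrite fn lte_fin.
apply: (@le_trans _ _ (\sum_(0 <= k <oo) f k)%E); last first.
  by rewrite leeDr// measure_ge0.
apply: le_trans (nneseries_lim_ge n.+1 _); last by move=> k _ _; exact: f0.
by rewrite big_nat_recr//= leeDr// sume_ge0.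
Qed.

Lemma lebesgue_model_nonatomic B : (forall n, (p n)%:num = 0) ->
  lebesgue_model s p B = lebesgue_measure (B `&` [set` `[0%R, s%:num]]).
Proof.
move=> p0; rewrite lebesgue_modelE eseries0 ?adde0// => n _ _.
by rewrite p0 mul0e.
Qed.

End model.

(** A model point of positive mass would give an atom of [mu], so all [p n] vanish and the interval
    remains, with [s > 0] as [mu] is nonzero. Its coding passes to [mu], through the completion if
    the isomorphism requires it. *)
Lemma nonatomic_lebesgue_coding (R : realType) (d : measure_display) (T : measurableType d)
    (mu : {measure set T -> \bar R}) :
  lebesgue_space mu -> nonatomic mu -> (0 < mu [set: T])%E ->
  exists delta, binary_coding mu delta.
Proof.
move=> [s [p iso]] na mu0.
have ms y : measurable ([set y] : set (measurableTypeR R)) by exact: measurable_set1.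
have msc y : measurable ([set y] : set (caratheodory_type ((lebesgue_model s p)^*)%mu)).
  exact: caratheodory_measurable_mu_ext.
have cE (A : set (measurableTypeR R)) : measurable A ->
    (@completed_measure_extension _ _ _ (lebesgue_model s p)
      : {measure set (caratheodory_type ((lebesgue_model s p)^*)%mu) -> \bar R}) A =
    lebesgue_model s p A.
  by move=> mA; exact: measurable_mu_extE.
have p0 n : (p n)%:num = 0.
  apply/eqP; rewrite eq_le ge0 andbT leNgt; apply/negP => /(lebesgue_model_point s) pn.
  case: iso => iso.
    by have [A /na] := isomorphic_mod0_atom iso (ms _) pn.
  have [] := isomorphic_mod0_atom iso (msc (- n.+1%:R)); last by move=> A /na.
  by rewrite cE//; exact: ms.
have modelE B := lebesgue_model_nonatomic s B p0.
have modelT : lebesgue_model s p setT = (s%:num)%:E.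
  rewrite modelE setTI lebesgue_measure_itv /= lte_fin oppr0 adde0; case: ltP => // s0.
  by congr EFin; apply/eqP; rewrite eq_le s0 ge0.
have s0 : 0 < s%:num.
  rewrite -lte_fin -modelT; case: iso => iso.
    by rewrite -(isomorphic_mod0_setT iso).
  by rewrite -cE// -(isomorphic_mod0_setT iso).
have mcoding : binary_coding (lebesgue_model s p) (interval_digits s%:num).
  by apply: interval_binary_coding => // B mB; exact: modelE.
case: iso => iso; first exact: isomorphic_mod0_coding iso mcoding.
apply: isomorphic_mod0_coding iso _; apply: completion_binary_coding => //.
  by rewrite modelT ltry.
exact: mcoding.
Qed.

Theorem theorem4p8 (R : realType) (d : measure_display) (T : measurableType d)
    (mu : {finite_measure set T -> \bar R})
    (mu_lebesgue : lebesgue_space mu) (mu_nonatomic : nonatomic mu)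
    (mu_neq0 : (0 < mu [set: T])%E) :
  ~ amenable R (Aut mu).
Proof.
have [delta coding] := nonatomic_lebesgue_coding mu_lebesgue mu_nonatomic mu_neq0.
exact: binary_coding_nonamenable coding.
Qed.
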